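(* Let $\alpha\in[0,\tfrac12]$, and let $(K_{i,j})_{i,j\ge1}$, $(J_{i,j})_{i,j\ge 1}$ be real numbers with $0\le K_{i,j}=K_{j,i}\le\kappa_2(ij)^\alpha$ and $0\le J_{i,j}=J_{j,i}\le\kappa_3(ij)^\alpha$ for all $i,j\ge1$, where $\kappa_2,\kappa_3>0$. Let $(a^1,b^1)$ and $(a^2,b^2)$ be solutions on $[0,\infty)$ of the coagulation--annihilation system with rates $K$, $J$ and with initial conditions $(a^1(0),b^1(0))=(a_0^1,b_0^1)$ and $(a^2(0),b^2(0))=(a_0^2,b_0^2)$ respectively, where $a_0^1,a_0^2,b_0^1,b_0^2\in X_1^+$. Let $\beta\in\mathbb{R}$ satisfy $\alpha\le\beta$ and $\alpha+\beta\le1$. Set $$C_1=\kappa_2(\|a_0^1\|_1+\|a_0^2\|_1),\quad C_2=\kappa_3\|a_0^1\|_1,\quad C_3=\kappa_2(\|b_0^1\|_1+\|b_0^2\|_1),\quad C_4=\kappa_3\|b_0^1\|_1,$$ $$K'=\max\{C_1+C_4,\;C_2+C_3\}.$$ Then, for every $t\ge0$, $$\|(a^1(t),b^1(t))-(a^2(t),b^2(t))\|_\beta\le C_5(K',t)\,\|(a^1(0),b^1(0))-(a^2(0),b^2(0))\|_\beta,$$ where $C_5(K',t)$ is a positive constant depending only on $K'$ and $t$.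
   Context: For $p\in\mathbb{R}$, $X_p$ is the space of real sequences $x=(x_i)_{i\ge1}$ with $\|x\|_p=\sum_{i=1}^\infty i^p|x_i|<\infty$, and $X_p^+=\{x\in X_p: x_i\ge0\text{ for all }i\ge1\}$. For pairs of sequences, $\|(x,y)\|_\beta=\|x\|_\beta+\|y\|_\beta$. The coagulation--annihilation system is, for $i\in\mathbb{N}=\{1,2,\dots\}$ and $t>0$, $$\frac{da_i}{dt}=\frac12\sum_{j=1}^{i-1}K_{j,i-j}a_ja_{i-j}-\sum_{j=1}^\infty K_{i,j}a_ia_j-\sum_{j=1}^\infty J_{i,j}a_ib_j,\qquad \frac{db_i}{dt}=\frac12\sum_{j=1}^{i-1}K_{j,i-j}b_jb_{i-j}-\sum_{j=1}^\infty K_{i,j}b_ib_j-\sum_{j=1}^\infty J_{i,j}b_ia_j$$ (for $i=1$ the first sums are zero), with non-negative initial data $a_i(0)=a_i^0$, $b_i(0)=b_i^0$. Solution: for $T\in(0,\infty]$, a pair $(a,b)=((a_i)_{i\ge1},(b_i)_{i\ge1})$ of sequences of non-negative functions is a solution on $[0,T)$ with initial data $(a^0,b^0)$ if (1) $a_i,b_i\in C([0,T))$ for each $i\in\mathbb{N}$; (2) for each $i\in\mathbb{N}$ and $t\in[0,T)$, the functions $\sum_{j=1}^\infty K_{i,j}a_j$, $\sum_{j=1}^\infty K_{i,j}b_j$, $\sum_{j=1}^\infty J_{i,j}a_j$, $\sum_{j=1}^\infty J_{i,j}b_j$ belong to $L^1(0,t)$; (3) for each $i\in\mathbb{N}$ and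 $t\in(0,T)$, $$a_i(t)=a_i^0+\int_0^t\Big(\tfrac12\sum_{j=1}^{i-1}K_{j,i-j}a_j(s)a_{i-j}(s)-a_i(s)\sum_{j=1}^\infty K_{i,j}a_j(s)-a_i(s)\sum_{j=1}^\infty J_{i,j}b_j(s)\Big)ds,$$ $$b_i(t)=b_i^0+\int_0^t\Big(\tfrac12\sum_{j=1}^{i-1}K_{j,i-j}b_j(s)b_{i-j}(s)-b_i(s)\sum_{j=1}^\infty K_{i,j}b_j(s)-b_i(s)\sum_{j=1}^\infty J_{i,j}a_j(s)\Big)ds.$$ *)

(* Defs.v *)
From HB Require Import structures.
From mathcomp Require Import all_boot all_order all_algebra.
From mathcomp Require Import all_classical all_reals all_analysis.

Set Implicit Arguments.
Unset Strict Implicit.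
Unset Printing Implicit Defensive.

Import Order.TTheory GRing.Theory Num.Theory.
Import numFieldNormedType.Exports.
Local Open Scope classical_set_scope.
Local Open Scope ring_scope.

(** Sequences (x_i)_{i >= 1} are functions on [nat] whose value at 0 is never
    used: all sums start at 1 and all quantifiers over indices assume [0 < i].
    A time-dependent sequence is [a : nat -> R -> R], with [a i t] for a_i(t). *)

(** The norm takes the value [+oo] exactly outside of X_p. *)
Definition wnorm (R : realType) (p : R) (x : nat -> R) : \bar R :=
  (\sum_(1 <= i <oo) (i%:R `^ p * `|x i|)%:E)%E.

Definition wnorm2 (R : realType) (p : R) (x y : nat -> R) : \bar R :=
  (wnorm p x + wnorm p y)%E.

Definition Xplus (R : realType) (p : R) (x : nat -> R) : Prop :=
  (wnorm p x < +oo)%E /\ (forall i : nat, (0 < i)%N -> 0 <= x i).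

Definition rate_kernel (R : realType) (kappa alpha : R) (K : nat -> nat -> R) :
    Prop :=
  forall i j : nat, (0 < i)%N -> (0 < j)%N ->
    [/\ 0 <= K i j, K i j = K j i & K i j <= kappa * (i * j)%:R `^ alpha].

(** sum_j K_{i,j} x_j, which may be [+oo] at some times (necessarily a null set
    of times along a solution), hence the values in [\bar R]. *)
Definition rate_sum (R : realType) (K : nat -> nat -> R) (i : nat)
    (x : nat -> R) : \bar R :=
  (\sum_(1 <= j <oo) (K i j * x j)%:E)%E.

(** The right-hand side of the equation for a_i; the one for b_i is obtained by
    exchanging [x] and [y]. *)
Definition ca_rhs (R : realType) (K J : nat -> nat -> R) (i : nat)
    (x y : nat -> R) : \bar R :=
  ((2^-1 * \sum_(1 <= j < i) K j (i - j)%N * x j * x (i - j)%N)%:E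
   - (x i)%:E * rate_sum K i x - (x i)%:E * rate_sum J i y)%E.

(** Solution on [0, T) with initial data (a0, b0); T may be [+oo].  By continuity
    and the integral equations, [a i 0 = a0 i] and [b i 0 = b0 i]. *)
Definition is_solution (R : realType) (K J : nat -> nat -> R) (T : \bar R)
    (a0 b0 : nat -> R) (a b : nat -> R -> R) : Prop :=
  let mu := @lebesgue_measure R in
  let D := [set t : R | 0 <= t /\ (t%:E < T)%E] in
  forall i : nat, (0 < i)%N ->
  [/\ (forall t, D t -> 0 <= a i t /\ 0 <= b i t),
      {within D, continuous (a i)} /\ {within D, continuous (b i)},
      (forall t, D t ->
        [/\ mu.-integrable `]0, t[ (fun s => rate_sum K i (a ^~ s)),
            mu.-integrable `]0, t[ (fun s => rate_sum K i (b ^~ s)),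
            mu.-integrable `]0, t[ (fun s => rate_sum J i (a ^~ s)) &
            mu.-integrable `]0, t[ (fun s => rate_sum J i (b ^~ s))]) &
      (forall t, D t -> 0 < t ->
        (a i t)%:E = ((a0 i)%:E
          + \int[mu]_(s in `]0%R, t[) ca_rhs K J i (a ^~ s) (b ^~ s))%E /\
        (b i t)%:E = ((b0 i)%:E
          + \int[mu]_(s in `]0%R, t[) ca_rhs K J i (b ^~ s) (a ^~ s))%E)].

(* Main.v *)
(** Write [u = a^1 - a^2], [v = b^1 - b^2], [s = a^1 + a^2], [w_i = i^beta].
    Multiplying the equation of [u_i] by [w_i sgn(u_i)] and summing, the
    coagulation terms contribute at most
    [1/2 sum K_{j,k} (w_{j+k} + w_j - w_k) s_j |u_k|], and subadditivity of [w]
    leaves [sum K_{j,k} w_j s_j |u_k| <= kappa_2 ||s||_1 ||u||_beta].  Splitting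
    [a^1_i b^1_j - a^2_i b^2_j = a^1_i v_j + u_i b^2_j], the annihilation terms
    contribute at most [kappa_3 ||a^1||_1 ||v||_beta].  Since the mass does not
    increase, Gronwall gives the constant [exp(K' t)].

    Both bounds hold exactly for the sums over [i < n], with full norms on the
    right, so no tail has to be controlled.  The mass bound makes every
    right-hand side bounded, so components are Lipschitz in time; over a short
    time step the signs can then be frozen at its right end at the cost of an
    error quadratic in the step, which vanishes by subdivision and spares the
    chain rule for [|u_i|]. *)

Require Import Defs.
From HB Require Import structures.
From mathcomp Require Import all_boot all_order all_algebra.
From mathcomp Require Import all_classical all_reals all_analysis.
From mathcomp Require Import lra ring.

Set Implicit Arguments.
Unset Strict Implicit.
Unset Printing Implicit Defensive.

Import Order.TTheory GRing.Theory Num.Theory.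
Import numFieldNormedType.Exports.
Local Open Scope classical_set_scope.
Local Open Scope ring_scope.

(** * Truncated right-hand sides *)

Lemma ler_sum_nat_widen (R : numDomainType) (F : nat -> R) (m n N : nat) :
  (n <= N)%N -> (forall i, (m <= i)%N -> 0 <= F i) ->
  \sum_(m <= i < n) F i <= \sum_(m <= i < N) F i.
Proof.
move=> nN F0; have [mn|nm] := leqP m n; last first.
  by rewrite big_geq 1?ltnW// big_nat sumr_ge0// => i /andP[/F0].
by rewrite (big_cat_nat mn nN)/= lerDl big_nat sumr_ge0// => i /andP[/(leq_trans mn)/F0].
Qed.

(** With $k=i-j$ the left side runs over the triangle $j+k<n$, which lies inside the square on the
    right. *)
Lemma sum_convolution_le (R : numDomainType) (H : nat -> nat -> R) (n : nat) :
  (forall j k, (0 < j)%N -> (0 < k)%N -> 0 <= H j k) ->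
  \sum_(1 <= i < n) \sum_(1 <= j < i) H j (i - j)%N <=
  \sum_(1 <= j < n) \sum_(1 <= k < n) H j k.
Proof.
move=> H0.
have -> : \sum_(1 <= i < n) \sum_(1 <= j < i) H j (i - j)%N =
    \sum_(1 <= i < n) \sum_(1 <= j < n | (j < i)%N) H j (i - j)%N.
  rewrite !big_nat; apply: eq_bigr => i /andP[_ iltn].
  by rewrite (big_nat_widen _ _ _ _ _ (ltnW iltn)).
rewrite (exchange_big_dep_nat xpredT)//= !big_nat; apply: ler_sum => j /andP[j1 jn].
have -> : \sum_(1 <= i < n | (j < i)%N) H j (i - j)%N =
    \sum_(1 <= k < n - j) H j k.
  transitivity (\sum_(1 + j <= i < n) H j (i - j)%N).
    by rewrite [RHS](@big_nat_widenl _ _ _ _ 1) ?add1n.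
  by rewrite big_addn; apply: eq_bigr => k _; rewrite addnK.
by apply: ler_sum_nat_widen => [|i i0]; [exact: leq_subr|exact: H0].
Qed.

(** Only the two loss sums are cut, at [N]; the gain sum is finite already. Unlike [ca_rhs], the
    value is always a real number. *)
Definition trunc_rhs (R : realType) (K J : nat -> nat -> R) (N i : nat)
    (x y : nat -> R) : R :=
  2^-1 * \sum_(1 <= j < i) K j (i - j)%N * x j * x (i - j)%N
  - x i * \sum_(1 <= j < N) K i j * x j - x i * \sum_(1 <= j < N) J i j * y j.

(** Coagulation of $j$ and $k$ takes away the mass $j+k$ and gives it back only if $j+k<n$, so
    truncation can only lose mass. Annihilation only removes mass. *)
Lemma trunc_mass_rate_le0 (R : realType) (kappa kappa' alpha : R)
    (K J : nat -> nat -> R) (n : nat) (x y : nat -> R) :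
  rate_kernel kappa alpha K -> rate_kernel kappa' alpha J ->
  (forall i, (0 < i)%N -> 0 <= x i) -> (forall i, (0 < i)%N -> 0 <= y i) ->
  \sum_(1 <= i < n) i%:R * trunc_rhs K J n i x y <= 0.
Proof.
move=> hK hJ x0 y0.
pose H j k := (j + k)%:R * (K j k * x j * x k).
pose D j k := j%:R * (K j k * x j * x k).
have H0 j k : (0 < j)%N -> (0 < k)%N -> 0 <= H j k.
  move=> j0 k0; have [K0 _ _] := hK j k j0 k0.
  by rewrite /H !mulr_ge0// ?x0.
have gain : \sum_(1 <= i < n) i%:R * \sum_(1 <= j < i) K j (i - j)%N * x j * x (i - j)%N
    <= 2 * \sum_(1 <= j < n) \sum_(1 <= k < n) D j k.
  (* By symmetry of [K], the weight $j+k$ may be replaced by $2j$ over the full square. *)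
  have -> : 2 * \sum_(1 <= j < n) \sum_(1 <= k < n) D j k =
      \sum_(1 <= j < n) \sum_(1 <= k < n) H j k.
    rewrite mulr_natl mulr2n {1}exchange_big_nat/= -big_split/=.
    rewrite big_nat [RHS]big_nat; apply: eq_bigr => j /andP[j0 _].
    rewrite -big_split/= big_nat [RHS]big_nat; apply: eq_bigr => k /andP[k0 _].
    have [_ Kjk _] := hK j k j0 k0.
    rewrite /D /H -Kjk natrD; ring.
  apply: le_trans (sum_convolution_le n H0).
  rewrite !big_nat; apply: ler_sum => i /andP[i0 _].
  rewrite mulr_sumr !big_nat; apply: ler_sum => j /andP[j0 ji].
  by rewrite /H subnKC// ltnW.
have loss i : (0 < i)%N -> i%:R * trunc_rhs K J n i x y <=
    2^-1 * (i%:R * \sum_(1 <= j < i) K j (i - j)%N * x j * x (i - j)%N)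
    - \sum_(1 <= j < n) D i j.
  move=> i0; rewrite /trunc_rhs.
  have -> : \sum_(1 <= j < n) D i j = i%:R * (x i * \sum_(1 <= j < n) K i j * x j).
    rewrite !mulr_sumr; apply: eq_bigr => j _; rewrite /D; ring.
  suff : 0 <= i%:R * (x i * \sum_(1 <= j < n) J i j * y j) by lra.
  rewrite !mulr_ge0 ?x0// big_nat sumr_ge0// => j /andP[j0 _].
  by have [J0 _ _] := hJ i j i0 j0; rewrite mulr_ge0// y0.
apply: (@le_trans _ _ (\sum_(1 <= i < n)
    (2^-1 * (i%:R * \sum_(1 <= j < i) K j (i - j)%N * x j * x (i - j)%N)
    - \sum_(1 <= j < n) D i j))).
  by rewrite !big_nat; apply: ler_sum => i /andP[i0 _]; exact: loss.
rewrite big_split/= sumrN -mulr_sumr; lra.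
Qed.

(** Here $i^\beta(ij)^\alpha=i^{\alpha+\beta}j^\alpha$; the condition $\alpha+\beta\le1$ bounds the
    first power by $i$, and $\alpha\le\beta$ bounds the second by $j^\beta$. *)
Lemma rate_kernel_weight_le (R : realType) (kappa alpha beta : R)
    (K : nat -> nat -> R) (i j : nat) :
  0 <= alpha -> alpha <= beta -> alpha + beta <= 1 -> 0 < kappa ->
  rate_kernel kappa alpha K -> (0 < i)%N -> (0 < j)%N ->
  i%:R `^ beta * K i j <= kappa * i%:R * j%:R `^ beta.
Proof.
move=> a0 ab ab1 k0 hK i0 j0; have [_ _ Kij] := hK i j i0 j0.
apply: (@le_trans _ _ (i%:R `^ beta * (kappa * (i * j)%:R `^ alpha))).
  by rewrite ler_wpM2l ?powR_ge0.
rewrite natrM powRM// mulrCA -[leRHS]mulrA ler_pM2l// mulrA -powRD; last first.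
  by rewrite pnatr_eq0 -lt0n i0 implybT.
apply: ler_pM; rewrite ?powR_ge0//.
  rewrite -[leRHS]powRr1//; apply: ler_powR; last lra.
  by rewrite ler1n.
by apply: ler_powR => //; rewrite ler1n.
Qed.

(** For $q=m/(j+k)\in(0,1]$ one has $q\le q^\beta$. Multiplying by $(j+k)^\beta$ and adding the
    cases $m=j$ and $m=k$ gives the claim. *)
Lemma powR_natD_le (R : realType) (beta : R) (j k : nat) :
  0 <= beta <= 1 -> (0 < j)%N -> (0 < k)%N ->
  ((j + k)%:R `^ beta <= j%:R `^ beta + k%:R `^ beta :> R).
Proof.
move=> /andP[b0 b1] j0 k0.
have jk0 : 0 < (j + k)%:R :> R by rewrite ltr0n addn_gt0 j0.
have key m : (0 < m <= j + k)%N ->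
    m%:R / (j + k)%:R * (j + k)%:R `^ beta <= m%:R `^ beta :> R.
  move=> /andP[m0 mjk].
  set q := m%:R / _.
  have q0 : 0 < q by rewrite divr_gt0// ltr0n.
  have -> : m%:R `^ beta = q `^ beta * (j + k)%:R `^ beta.
    by rewrite -powRM ?(ltW q0)// divfK// gt_eqF.
  rewrite ler_wpM2r ?powR_ge0// -[leLHS]powRr1 ?(ltW q0)//.
  apply: ger_powR => //; rewrite q0/= ler_pdivrMr// mul1r ler_nat//.
apply: le_trans (lerD (key j _) (key k _)); rewrite ?j0 ?k0 ?leq_addr ?leq_addl//.
by rewrite -mulrDl -mulrDl -natrD divff ?mul1r// gt_eqF.
Qed.

(** The coagulation loss is split symmetrically, $pq-p'q'=\frac12(p+p')(q-q')+\frac12(p-p')(q+q')$,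
    and the annihilation loss as $pq-p'q'=p(q-q')+(p-p')q'$. The last line collects all terms with
    the factor $x_i-x'_i$; these are the damping terms. *)
Lemma trunc_rhs_diff (R : realType) (K J : nat -> nat -> R) (N i : nat)
    (x x' y y' : nat -> R) :
  trunc_rhs K J N i x y - trunc_rhs K J N i x' y' =
  2^-1 * \sum_(1 <= j < i)
      K j (i - j)%N * (x j * x (i - j)%N - x' j * x' (i - j)%N)
  - 2^-1 * (x i + x' i) * \sum_(1 <= j < N) K i j * (x j - x' j)
  - x i * \sum_(1 <= j < N) J i j * (y j - y' j)
  - (x i - x' i) * (2^-1 * \sum_(1 <= j < N) K i j * (x j + x' j)
                    + \sum_(1 <= j < N) J i j * y' j).
Proof.
have split_sub (F : nat -> R) (z z' : nat -> R) m : \sum_(1 <= j < m) F j * (z j - z' j) =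
    \sum_(1 <= j < m) F j * z j - \sum_(1 <= j < m) F j * z' j.
  by rewrite -sumrB; apply: eq_bigr => j _; rewrite mulrBr.
have split_add (F : nat -> R) (z z' : nat -> R) m : \sum_(1 <= j < m) F j * (z j + z' j) =
    \sum_(1 <= j < m) F j * z j + \sum_(1 <= j < m) F j * z' j.
  by rewrite -big_split; apply: eq_bigr => j _; rewrite mulrDr.
have assoc z : \sum_(1 <= j < i) K j (i - j)%N * z j * z (i - j)%N =
    \sum_(1 <= j < i) K j (i - j)%N * (z j * z (i - j)%N).
  by apply: eq_bigr => j _; rewrite mulrA.
rewrite !split_sub split_add /trunc_rhs !assoc.
by field.
Qed.

(** The multiplier [sg] turns the damping terms into $-|x_i-x'_i|$ times a non-negative factor, up
    to the defect [e]; all other terms are bounded by absolute values. *)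
Lemma trunc_rhs_diff_le (R : realType) (kappa kappa' alpha : R)
    (K J : nat -> nat -> R) (N i : nat) (x x' y y' : nat -> R) (sg e : R) :
  rate_kernel kappa alpha K -> rate_kernel kappa' alpha J -> (0 < i)%N ->
  (forall j, (0 < j)%N -> [/\ 0 <= x j, 0 <= x' j & 0 <= y' j]) ->
  `|sg| <= 1 -> `|x i - x' i| - e <= sg * (x i - x' i) ->
  sg * (trunc_rhs K J N i x y - trunc_rhs K J N i x' y') <=
  2^-1 * \sum_(1 <= j < i)
      K j (i - j)%N * ((x j + x' j) * `|x (i - j)%N - x' (i - j)%N|)
  + 2^-1 * \sum_(1 <= j < N) K i j * (x i + x' i) * `|x j - x' j|
  + \sum_(1 <= j < N) J i j * x i * `|y j - y' j|
  - 2^-1 * \sum_(1 <= j < N) K i j * `|x i - x' i| * (x j + x' j)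
  + e * (2^-1 * \sum_(1 <= j < N) K i j * (x j + x' j)
         + \sum_(1 <= j < N) J i j * y' j).
Proof.
move=> hK hJ i0 pos sg1 he; have [xi0 x'i0 _] := pos i i0.
have sgle z : sg * z <= `|z|.
  by rewrite (le_trans (ler_norm _))// normrM ler_piMl.
have sgsum (F : nat -> R) (z : nat -> R) c m : 0 <= c ->
    (forall j, (0 < j < m)%N -> 0 <= F j) ->
    - (sg * (c * \sum_(1 <= j < m) F j * z j)) <= \sum_(1 <= j < m) F j * c * `|z j|.
  move=> c0 F0; rewrite -mulNr !mulr_sumr !big_nat; apply: ler_sum => j jm.
  rewrite (_ : - sg * (c * (F j * z j)) = F j * c * (sg * - z j)); last by ring.
  by rewrite ler_wpM2l ?mulr_ge0 ?F0// (le_trans (sgle _))// normrN.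
have K0 j : (0 < j < N)%N -> 0 <= K i j by case/andP=> j0 _; case: (hK i j i0 j0).
have J0 j : (0 < j < N)%N -> 0 <= J i j by case/andP=> j0 _; case: (hJ i j i0 j0).
rewrite trunc_rhs_diff.
have gain : sg * \sum_(1 <= j < i)
      K j (i - j)%N * (x j * x (i - j)%N - x' j * x' (i - j)%N) <=
    \sum_(1 <= j < i)
      K j (i - j)%N * ((x j + x' j) * `|x (i - j)%N - x' (i - j)%N|).
  (* The reflection $j\mapsto i-j$ and the symmetry of [K] show that both halves of the symmetrised
     product contribute the same sum. *)
  have rev : \sum_(1 <= j < i)
      K j (i - j)%N * ((x j + x' j) * `|x (i - j)%N - x' (i - j)%N|) =
      \sum_(1 <= j < i)
      K j (i - j)%N * ((x (i - j)%N + x' (i - j)%N) * `|x j - x' j|).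
    rewrite big_nat_rev/= big_nat [RHS]big_nat; apply: eq_bigr => j /andP[j0 ji].
    rewrite add1n subSS subKn ?(ltnW ji)//.
    have ij0 : (0 < i - j)%N by rewrite subn_gt0.
    by have [_ -> _] := hK _ _ ij0 j0.
  suff : sg * \sum_(1 <= j < i)
      K j (i - j)%N * (x j * x (i - j)%N - x' j * x' (i - j)%N) <=
    2^-1 * (\sum_(1 <= j < i)
      K j (i - j)%N * ((x j + x' j) * `|x (i - j)%N - x' (i - j)%N|)
     + \sum_(1 <= j < i)
      K j (i - j)%N * ((x (i - j)%N + x' (i - j)%N) * `|x j - x' j|)).
    by rewrite -rev; lra.
  rewrite -big_split/= !mulr_sumr !big_nat; apply: ler_sum => j /andP[j0 ji].
  have ij0 : (0 < i - j)%N by rewrite subn_gt0.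
  have [Kj0 _ _] := hK _ _ j0 ij0.
  have [xj0 x'j0 _] := pos j j0; have [xij0 x'ij0 _] := pos _ ij0.
  rewrite -mulrDr mulrCA [leRHS]mulrCA ler_wpM2l//.
  have -> : x j * x (i - j)%N - x' j * x' (i - j)%N =
    2^-1 * ((x j + x' j) * (x (i - j)%N - x' (i - j)%N)
            + (x (i - j)%N + x' (i - j)%N) * (x j - x' j)) by field.
  rewrite mulrCA ler_wpM2l ?invr_ge0// mulrDr; apply: lerD.
    by rewrite mulrCA ler_wpM2l ?addr_ge0.
  by rewrite mulrCA ler_wpM2l ?addr_ge0.
have lossK := sgsum (K i) (fun j => x j - x' j) (x i + x' i) N (addr_ge0 xi0 x'i0) K0.
have lossJ := sgsum (J i) (fun j => y j - y' j) (x i) N xi0 J0.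
have absorbK : \sum_(1 <= j < N) K i j * `|x i - x' i| * (x j + x' j) =
    `|x i - x' i| * \sum_(1 <= j < N) K i j * (x j + x' j).
  by rewrite mulr_sumr; apply: eq_bigr => j _; ring.
rewrite absorbK.
set Ks := \sum_(1 <= j < N) K i j * (x j + x' j).
set Jy := \sum_(1 <= j < N) J i j * y' j.
have Ks0 : 0 <= Ks.
  rewrite /Ks big_nat sumr_ge0// => j /andP[j0 jN].
  by have [? ? _] := pos j j0; rewrite mulr_ge0 ?K0 ?j0 ?addr_ge0.
have Jy0 : 0 <= Jy.
  rewrite /Jy big_nat sumr_ge0// => j /andP[j0 jN].
  by have [_ _ ?] := pos j j0; rewrite mulr_ge0 ?J0 ?j0.
have p0 : 0 <= 2^-1 * Ks + Jy by rewrite addr_ge0// mulr_ge0.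
(* Only the coagulation part of the damping is kept; the annihilation part has a favourable sign and
   is dropped. *)
have damp : - (sg * ((x i - x' i) * (2^-1 * Ks + Jy))) <=
    - 2^-1 * (`|x i - x' i| * Ks) + e * (2^-1 * Ks + Jy).
  have := ler_wpM2r p0 he.
  have : 0 <= `|x i - x' i| * Jy by rewrite mulr_ge0.
  by rewrite -!mulrA; lra.
move: gain lossK lossJ damp; rewrite /=.
set S1 := \sum_(1 <= j < i) _; set S2 := \sum_(1 <= j < i) _.
set S3 := \sum_(1 <= j < N) _; set S4 := \sum_(1 <= j < N) _.
set S5 := \sum_(1 <= j < N) _; set S6 := \sum_(1 <= j < N) _.
move=> gain lossK lossJ damp.
have -> : sg * (2^-1 * S1 - 2^-1 * (x i + x' i) * S3 - x i * S5
      - (x i - x' i) * (2^-1 * Ks + Jy)) =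
    2^-1 * (sg * S1) + 2^-1 * - (sg * ((x i + x' i) * S3)) + - (sg * (x i * S5))
    + - (sg * ((x i - x' i) * (2^-1 * Ks + Jy))) by ring.
lra.
Qed.

(** Termwise use of [rate_kernel_weight_le]: the factor [x] receives the mass weight $i$, and the
    weight $\beta$ moves to [z]. *)
Lemma weighted_bilinear_le (R : realType) (kappa alpha beta : R)
    (K : nat -> nat -> R) (n N : nat) (x z : nat -> R) :
  0 <= alpha -> alpha <= beta -> alpha + beta <= 1 -> 0 < kappa ->
  rate_kernel kappa alpha K ->
  (forall i, (0 < i)%N -> 0 <= x i) -> (forall i, (0 < i)%N -> 0 <= z i) ->
  \sum_(1 <= i < n) i%:R `^ beta * \sum_(1 <= j < N) K i j * x i * z j <=
  kappa * (\sum_(1 <= i < n) i%:R * x i) * \sum_(1 <= j < N) j%:R `^ beta * z j.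
Proof.
move=> a0 ab ab1 k0 hK x0 z0.
rewrite -mulrA mulr_suml mulr_sumr !big_nat; apply: ler_sum => i /andP[i0 _].
rewrite !mulr_sumr !big_nat; apply: ler_sum => j /andP[j0 _].
rewrite (_ : i%:R `^ beta * _ = i%:R `^ beta * K i j * (x i * z j)); last by ring.
rewrite (_ : kappa * _ = kappa * i%:R * j%:R `^ beta * (x i * z j)); last by ring.
by rewrite ler_wpM2r ?mulr_ge0 ?x0 ?z0// (rate_kernel_weight_le a0 ab ab1 k0 hK).
Qed.

(* In the gain term, [w_{j+k} <= w_j + w_k]; the part with [w_k s_j |u_k|] is
   cancelled by the loss term damping [|u_k|].  The sequence [e] measures how
   far the multipliers [sg] are from being the signs of [x - x']. *)
Lemma weighted_trunc_rhs_diff_le (R : realType) (kappa kappa' alpha beta : R)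
    (K J : nat -> nat -> R) (n N : nat) (x x' y y' : nat -> R) (sg e : nat -> R) :
  0 <= alpha -> alpha <= beta -> alpha + beta <= 1 -> 0 < kappa -> 0 < kappa' ->
  rate_kernel kappa alpha K -> rate_kernel kappa' alpha J -> (n <= N)%N ->
  (forall i, (0 < i)%N -> [/\ 0 <= x i, 0 <= x' i & 0 <= y' i]) ->
  (forall i, (0 < i < n)%N ->
    `|sg i| <= 1 /\ `|x i - x' i| - e i <= sg i * (x i - x' i)) ->
  \sum_(1 <= i < n) i%:R `^ beta *
    (sg i * (trunc_rhs K J N i x y - trunc_rhs K J N i x' y')) <=
  kappa * (\sum_(1 <= i < n) i%:R * (x i + x' i))
    * (\sum_(1 <= i < N) i%:R `^ beta * `|x i - x' i|)
  + kappa' * (\sum_(1 <= i < n) i%:R * x i)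
    * (\sum_(1 <= i < N) i%:R `^ beta * `|y i - y' i|)
  + \sum_(1 <= i < n) i%:R `^ beta *
      (e i * (2^-1 * \sum_(1 <= j < N) K i j * (x j + x' j)
              + \sum_(1 <= j < N) J i j * y' j)).
Proof.
move=> a0 ab ab1 k0 k'0 hK hJ nN pos hsg.
pose w i : R := i%:R `^ beta; have w0 i : 0 <= w i by exact: powR_ge0.
pose s i := x i + x' i; pose u i := `|x i - x' i|; pose v i := `|y i - y' i|.
have s0 i : (0 < i)%N -> 0 <= s i by move=> /pos[? ? _]; rewrite addr_ge0.
have K0 i j : (0 < i)%N -> (0 < j)%N -> 0 <= K i j by move=> i0 j0; case: (hK i j i0 j0).
pose err i := e i * (2^-1 * \sum_(1 <= j < N) K i j * s j + \sum_(1 <= j < N) J i j * y' j).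
pose gain i := \sum_(1 <= j < i) K j (i - j)%N * (s j * u (i - j)%N).
(* In [D] the weight sits on the index of [s], in [E] on the index of [u]; [E] is the damping term
   and [P] comes from annihilation. *)
pose D N' i := w i * \sum_(1 <= j < N') K i j * s i * u j.
pose E N' i := w i * \sum_(1 <= j < N') K i j * u i * s j.
pose P i := w i * \sum_(1 <= j < N) J i j * x i * v j.
have step : \sum_(1 <= i < n) w i *
    (sg i * (trunc_rhs K J N i x y - trunc_rhs K J N i x' y')) <=
  2^-1 * (\sum_(1 <= i < n) w i * gain i) + 2^-1 * (\sum_(1 <= i < n) D N i)
  + (\sum_(1 <= i < n) P i) - 2^-1 * (\sum_(1 <= i < n) E N i)
  + \sum_(1 <= i < n) w i * err i.
  rewrite !mulr_sumr -sumrN -!big_split/= !big_nat; apply: ler_sum => i iln.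
  have [i0 _] := andP iln; have [sg1 he] := hsg i iln.
  have := ler_wpM2l (w0 i) (trunc_rhs_diff_le N y hK hJ i0 pos sg1 he).
  move=> /le_trans; apply; rewrite le_eqVlt; apply/orP; left; apply/eqP.
  by rewrite /D /E /P /gain /err /s /u /v; ring.
have gain_le : \sum_(1 <= i < n) w i * gain i <=
    \sum_(1 <= i < n) D n i + \sum_(1 <= i < n) E n i.
  pose H j k := w (j + k)%N * (K j k * (s j * u k)).
  have -> : \sum_(1 <= i < n) w i * gain i =
      \sum_(1 <= i < n) \sum_(1 <= j < i) H j (i - j)%N.
    apply: eq_bigr => i _; rewrite /gain mulr_sumr !big_nat.
    by apply: eq_bigr => j /andP[_ ji]; rewrite /H subnKC// ltnW.
  apply: (le_trans (sum_convolution_le n _)).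
    by move=> j k j0 k1; rewrite /H mulr_ge0// mulr_ge0 ?K0// mulr_ge0 ?s0// normr_ge0.
  have -> : \sum_(1 <= i < n) E n i =
      \sum_(1 <= j < n) \sum_(1 <= k < n) w k * (K j k * (s j * u k)).
    rewrite exchange_big_nat/= !big_nat; apply: eq_bigr => k /andP[k1 _].
    rewrite /E mulr_sumr !big_nat; apply: eq_bigr => j /andP[j1 _].
    by have [_ -> _] := hK k j k1 j1; ring.
  rewrite -big_split/= !big_nat; apply: ler_sum => j /andP[j1 _].
  rewrite /D mulr_sumr -big_split/= !big_nat; apply: ler_sum => k /andP[k1 _].
  rewrite (_ : w j * _ + _ = (w j + w k) * (K j k * (s j * u k))); last by ring.
  rewrite ler_wpM2r//.
    by rewrite mulr_ge0 ?K0// mulr_ge0 ?s0// normr_ge0.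
  by apply: powR_natD_le => //; apply/andP; split; lra.
(* The gain only produces inner sums up to [n]; enlarging them to [N] makes them comparable with the
   loss terms. *)
have widen F : (forall i j, (0 < i)%N -> (0 < j)%N -> 0 <= F i j) ->
    \sum_(1 <= i < n) w i * \sum_(1 <= j < n) F i j <=
    \sum_(1 <= i < n) w i * \sum_(1 <= j < N) F i j.
  move=> F0; rewrite !big_nat; apply: ler_sum => i /andP[i0 _].
  by rewrite ler_wpM2l// ler_sum_nat_widen// => j j0; exact: F0.
have D_le : \sum_(1 <= i < n) D n i <= \sum_(1 <= i < n) D N i.
  by apply: widen => i j i0 j0; rewrite mulr_ge0 ?s0 ?normr_ge0// mulr_ge0 ?K0 ?s0 ?normr_ge0.
have E_le : \sum_(1 <= i < n) E n i <= \sum_(1 <= i < n) E N i.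
  by apply: widen => i j i0 j0; rewrite mulr_ge0 ?s0 ?normr_ge0// mulr_ge0 ?K0 ?s0 ?normr_ge0.
have DN : \sum_(1 <= i < n) D N i <= _ :=
  weighted_bilinear_le n N a0 ab ab1 k0 hK s0 (fun i _ => normr_ge0 (x i - x' i)).
have x0 i : (0 < i)%N -> 0 <= x i by case/pos.
have PN : \sum_(1 <= i < n) P i <= _ :=
  weighted_bilinear_le n N a0 ab ab1 k'0 hJ x0 (fun i _ => normr_ge0 (y i - y' i)).
(* Half of [D] from the gain and half from the loss make one [D], while the [E] part of the gain is
   absorbed by the damping. *)
move: step gain_le D_le E_le DN PN; rewrite /err /s /u /v /w; lra.
Qed.

(** * Gronwall from finite increments *)

(** Cutting $[0,t]$ into $N+1$ equal steps bounds the total increment by $Ct^2/(N+1)$, and $N$ is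
    arbitrary. *)
Lemma le_of_quadratic_increments (R : realType) (f : R -> R) (C t : R) :
  0 <= t ->
  (forall r s, 0 <= r -> r <= s -> s <= t -> f s - f r <= C * (s - r) ^+ 2) ->
  f t <= f 0.
Proof.
move=> t0 incr.
have bound (N : nat) : N.+1%:R * (f t - f 0) <= C * t ^+ 2.
  pose p k : R := k%:R / N.+1%:R * t.
  have pS k : p k.+1 - p k = t / N.+1%:R by rewrite /p -natr1; ring.
  have -> : f t - f 0 = \sum_(0 <= k < N.+1) (f (p k.+1) - f (p k)).
    by rewrite telescope_sumr// /p divff ?pnatr_eq0// mul1r !mul0r.
  apply: (@le_trans _ _ (N.+1%:R * \sum_(0 <= k < N.+1) C * (t / N.+1%:R) ^+ 2)).
    rewrite ler_wpM2l// !big_nat; apply: ler_sum => k /andP[_ kN].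
    rewrite -(pS k); apply: incr.
    - by rewrite !mulr_ge0// invr_ge0.
    - by rewrite -subr_ge0 pS divr_ge0.
    - by rewrite /p ler_piMl// ler_pdivrMr// mul1r ler_nat.
  rewrite big_const_nat subn0 iter_addr_0 -mulr_natl.
  have N0 : N.+1%:R != 0 :> R by rewrite pnatr_eq0.
  by rewrite le_eqVlt; apply/orP; left; apply/eqP; field.
rewrite leNgt -subr_gt0; apply/negP => d0.
have := archi_boundP (divr_ge0 (normr_ge0 (C * t ^+ 2)) (ltW d0)).
set N := Num.bound _; rewrite ltr_pdivrMr// => ltN.
have := bound N; rewrite -natr1 mulrDl mul1r.
have := ler_norm (C * t ^+ 2); lra.
Qed.

(** A second-order Taylor bound at the right end [t]. It lets an exponential majorant offset a
    linear growth rate up to a quadratic error, as [le_of_quadratic_increments] requires. *)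
Lemma expR_increment_ge (R : realType) (k s t T : R) :
  0 <= k -> s <= t -> t <= T ->
  k * expR (k * t) * (t - s) <=
  expR (k * t) - expR (k * s) + k ^+ 2 * expR (k * T) * (t - s) ^+ 2.
Proof.
move=> k0 st tT; set h := t - s; have h0 : 0 <= h by rewrite subr_ge0.
set x := k * h; have x0 : 0 <= x by rewrite mulr_ge0.
(* Since $e^x\ge1+x$, it suffices that $(1-x+x^2)(1+x)=1+x^3\ge1$. *)
have expN : expR (- x) <= 1 - x + x ^+ 2.
  rewrite expRN -[leLHS]mul1r ler_pdivrMr ?expR_gt0//.
  have q0 : 0 <= 1 - x + x ^+ 2 by have := sqr_ge0 (x - 2^-1); nra.
  apply: le_trans (ler_wpM2l q0 (expR_ge1Dx x)).
  have : 0 <= x ^+ 3 by rewrite exprn_ge0.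
  lra.
have -> : expR (k * s) = expR (k * t) * expR (- x).
  by rewrite -expRD /x /h; congr expR; ring.
have := ler_wpM2l (expR_ge0 (k * t)) expN.
have : expR (k * t) <= expR (k * T) by rewrite ler_expR ler_wpM2l.
move=> /(ler_wpM2r (sqr_ge0 x)); rewrite /x exprMn; lra.
Qed.

(* [Y n] stands for the [n]-th partial sum of a norm: its growth is controlled
   by the full norm, hence by all the other partial sums. *)
Lemma gronwall_family (R : realType) (Y : nat -> R -> R) (k Y0 M : R) :
  0 <= k -> 0 <= Y0 -> 0 <= M ->
  (forall n t, 0 <= t -> Y n t <= M) -> (forall n, Y n 0 <= Y0) ->
  (forall n, exists C, forall s t g, 0 <= s -> s <= t ->
     (forall N r, s <= r -> r <= t -> Y N r <= g) ->
     Y n t - Y n s <= k * g * (t - s) + C * (t - s) ^+ 2) ->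
  forall n t, 0 <= t -> Y n t <= expR (k * t) * Y0.
Proof.
move=> k0 Y00 M0 YM Yinit incr.
(* Each pass halves the excess over the desired bound: an excess $Se^{2kt}$ in all partial sums
   enters the growth with the factor $k$, and $kSe^{2kt}$ is the derivative of $\frac S2e^{2kt}$.
   The exponent $2k$ is chosen for this. *)
have iter m : forall n t, 0 <= t ->
    Y n t <= expR (k * t) * Y0 + M / 2 ^+ m * expR (2 * k * t).
  elim: m => [|m IH] n t t0.
    rewrite expr0 divr1; apply: le_trans (YM n t t0) _.
    have e1 : 1 <= expR (2 * k * t).
      by rewrite -expR0 ler_expR !mulr_ge0.
    have := ler_wpM2l M0 e1; have := mulr_ge0 (expR_ge0 (k * t)) Y00; lra.
  set S := M / 2 ^+ m in IH.
  have S0 : 0 <= S by rewrite divr_ge0// exprn_ge0.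
  have -> : M / 2 ^+ m.+1 = S / 2 by rewrite /S exprS; field; rewrite expf_neq0.
  have [C HC] := incr n.
  pose f r := Y n r - Y0 * expR (k * r) - S / 2 * expR (2 * k * r).
  suff : f t <= f 0.
    rewrite /f !mulr0 !expR0; have := Yinit n; lra.
  apply: (@le_of_quadratic_increments _ _ (C + Y0 * (k ^+ 2 * expR (k * t))
      + S / 2 * ((2 * k) ^+ 2 * expR (2 * k * t)))) => // r s r0 rs st.
  have k20 : 0 <= 2 * k by rewrite mulr_ge0.
  have e1 := ler_wpM2l Y00 (expR_increment_ge k0 rs st).
  have S20 : 0 <= S / 2 by rewrite divr_ge0.
  have e2 := ler_wpM2l S20 (expR_increment_ge k20 rs st).
  (* The majorant is nondecreasing in time, so its value at the right end bounds every partial sum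
     on the whole step. *)
  have := HC r s (expR (k * s) * Y0 + S * expR (2 * k * s)) r0 rs.
  have hg N q : r <= q -> q <= s ->
      Y N q <= expR (k * s) * Y0 + S * expR (2 * k * s).
    move=> rq qs; apply: le_trans (IH N q (le_trans r0 rq)) _.
    apply: lerD; first by rewrite ler_wpM2r// ler_expR ler_wpM2l.
    by rewrite ler_wpM2l// ler_expR ler_wpM2l.
  by move=> /(_ hg); move: e1 e2; rewrite /f; lra.
(* The remaining excess $M2^{-m}e^{2kt}$ is made smaller than [e] through $m<2^m$. *)
move=> n t t0; apply/ler_addgt0Pr => e e0.
set c := M * expR (2 * k * t).
have c0 : 0 <= c by rewrite mulr_ge0// expR_ge0.
have := archi_boundP (divr_ge0 c0 (ltW e0)); set m := Num.bound _.
rewrite ltr_pdivrMr// => cm.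
apply: le_trans (iter m n t t0) _; rewrite lerD2l mulrAC -/c.
rewrite ler_pdivrMr ?exprn_gt0//; apply: le_trans (ltW cm) _.
by rewrite mulrC ler_wpM2l ?(ltW e0)// -natrX ler_nat ltnW// ltn_expl.
Qed.

(** * Primitives *)

(** The integral form on $[0,\infty)$ asks for no pointwise derivative and is stable under the
    finite linear combinations used below. *)
Definition is_primitive (R : realType) (f F : R -> R) : Prop :=
  forall s t : R, 0 <= s -> s <= t ->
  (@lebesgue_measure R).-integrable `]s, t[ (EFin \o F) /\
  f t - f s = \int[@lebesgue_measure R]_(r in `]s, t[) F r.

Lemma is_primitiveB (R : realType) (f g F G : R -> R) :
  is_primitive f F -> is_primitive g G ->
  is_primitive (fun t => f t - g t) (fun t => F t - G t).
Proof.
move=> hf hg s t s0 st; have [iF eF] := hf s t s0 st; have [iG eG] := hg s t s0 st.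
split.
  by rewrite (_ : _ \o _ = (EFin \o F) \- (EFin \o G))%E//; apply: integrableB.
by rewrite RintegralB// -eF -eG; ring.
Qed.

Lemma is_primitiveD (R : realType) (f g F G : R -> R) :
  is_primitive f F -> is_primitive g G ->
  is_primitive (fun t => f t + g t) (fun t => F t + G t).
Proof.
move=> hf hg s t s0 st; have [iF eF] := hf s t s0 st; have [iG eG] := hg s t s0 st.
split.
  by rewrite (_ : _ \o _ = (EFin \o F) \+ (EFin \o G))%E//; apply: integrableD.
by rewrite RintegralD// -eF -eG; ring.
Qed.

Lemma is_primitiveZ (R : realType) (c : R) (f F : R -> R) :
  is_primitive f F -> is_primitive (fun t => c * f t) (fun t => c * F t).
Proof.
move=> hf s t s0 st; have [iF eF] := hf s t s0 st; split.
  rewrite (_ : _ \o _ = (fun x => c%:E * (EFin \o F) x)%E)//.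
  exact: integrableZl.
by rewrite RintegralZl// -eF mulrBr.
Qed.

Lemma is_primitive_sum (R : realType) (n : nat) (f F : nat -> R -> R) :
  (forall i, (0 < i)%N -> is_primitive (f i) (F i)) ->
  is_primitive (fun t => \sum_(1 <= i < n) f i t)
               (fun t => \sum_(1 <= i < n) F i t).
Proof.
move=> hf; elim: n => [|[|n] IH].
- suff : is_primitive (fun=> 0) (fun=> 0 : R).
    by congr is_primitive; apply/funext => t; rewrite big_geq.
  move=> s t _ _; split; last by rewrite Rintegral_cst// mul0r subrr.
  exact: integrable0.
- by move: IH; congr is_primitive; apply/funext => t; rewrite !big_geq.
- have := is_primitiveD IH (hf n.+1 isT).
  by congr is_primitive; apply/funext => t; rewrite [in RHS]big_nat_recr.
Qed.

Lemma is_primitive_increment_le (R : realType) (f F : R -> R) (c s t : R) :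
  is_primitive f F -> 0 <= s -> s <= t ->
  (forall r, s < r -> r < t -> F r <= c) -> f t - f s <= c * (t - s).
Proof.
move=> hf s0 st Fc; have [iF ->] := hf s t s0 st.
have mu_st : @lebesgue_measure R `]s, t[ = (t - s)%:E.
  rewrite lebesgue_measure_itv/= lte_fin; case: ltP => [_|ts]; first by rewrite -EFinB.
  by have -> : s = t; [apply/eqP; rewrite eq_le st ts|rewrite subrr].
have mu_fin : (@lebesgue_measure R `]s, t[ < +oo)%E by rewrite mu_st ltry.
have -> : c * (t - s) = \int[@lebesgue_measure R]_(r in `]s, t[) c.
  by rewrite Rintegral_cst//; congr (_ * _); exact/esym/(congr1 fine mu_st).
apply: le_Rintegral => //.
  apply: (measurable_bounded_integrable _ mu_fin) => //.
  exists `|c|; split; first exact: num_real.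
  by move=> M cM x _ /=; exact: ltW.
by move=> r /=; rewrite in_itv/= => /andP[sr rt]; exact: Fc.
Qed.

Lemma is_primitive_lipschitz (R : realType) (f F : R -> R) (c s t : R) :
  is_primitive f F -> 0 <= s -> s <= t ->
  (forall r, s < r -> r < t -> `|F r| <= c) -> `|f t - f s| <= c * (t - s).
Proof.
move=> hf s0 st Fc.
have up : f t - f s <= c * (t - s).
  apply: (is_primitive_increment_le hf s0 st) => r sr rt.
  by have := Fc r sr rt; rewrite ler_norml => /andP[].
have lo : -1 * f t - -1 * f s <= c * (t - s).
  apply: is_primitive_increment_le (is_primitiveZ (-1) hf) s0 st _ => r sr rt.
  by have := Fc r sr rt; rewrite ler_norml => /andP[? _]; lra.
by rewrite ler_norml up andbT; lra.
Qed.

(** * Mass bound and regularity of solutions *)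

Lemma within_continuous_bounded_measurable (R : realType) (f : R -> R) (a b : R) :
  a <= b -> {within `[a, b], continuous f} ->
  measurable_fun `]a, b[ f /\ [bounded f x | x in `]a, b[].
Proof.
move=> ab cf; split.
  apply: measurable_realfun.subspace_continuous_measurable_fun => //.
  apply: continuous_subspaceW cf => x /=.
  by rewrite !in_itv/= => /andP[/ltW -> /ltW ->].
have [M [Mr HM]] := compact_bounded (continuous_compact cf (@segment_compact _ a b)).
exists M; split => // y My x /=; rewrite in_itv/= => /andP[ax xb].
by apply: (HM y My); exists x => //=; rewrite in_itv/= !ltW.
Qed.

(** The system is invariant under exchange of the two species, so every fact about [a] also yields
    one about [b]. *)
Lemma solution_swap (R : realType) (K J : nat -> nat -> R) (T : \bar R)
    (a0 b0 : nat -> R) (a b : nat -> R -> R) :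
  is_solution K J T a0 b0 a b -> is_solution K J T b0 a0 b a.
Proof.
move=> sol mu D i i0; have [pos [ca cb] int eqn] := sol i i0; split => //.
- by move=> t /pos[].
- by move=> t /int[].
- by move=> t Dt t0; have [] := eqn t Dt t0.
Qed.

Lemma solution_ge0 (R : realType) (K J : nat -> nat -> R)
    (a0 b0 : nat -> R) (a b : nat -> R -> R) (i : nat) (t : R) :
  is_solution K J +oo%E a0 b0 a b -> (0 < i)%N -> 0 <= t -> 0 <= a i t.
Proof. by move=> sol i0 t0; have [/(_ t)[]//=] := sol i i0; rewrite ltry. Qed.

Lemma solution_continuous (R : realType) (K J : nat -> nat -> R)
    (a0 b0 : nat -> R) (a b : nat -> R -> R) (i : nat) (t : R) :
  is_solution K J +oo%E a0 b0 a b -> (0 < i)%N -> {within `[0, t], continuous (a i)}.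
Proof.
move=> sol i0; have [_ [ca _] _ _] := sol i i0.
by apply: continuous_subspaceW ca => x /=; rewrite in_itv/= ltry => /andP[].
Qed.

(** Components are continuous, hence bounded and measurable on bounded intervals; multiplying the
    integrable rate sums by them preserves integrability. *)
Lemma solution_ca_rhs_integrable (R : realType) (K J : nat -> nat -> R)
    (a0 b0 : nat -> R) (a b : nat -> R -> R) (i : nat) (t : R) :
  is_solution K J +oo%E a0 b0 a b -> (0 < i)%N -> 0 <= t ->
  (@lebesgue_measure R).-integrable `]0, t[
    (fun s => ca_rhs K J i (a ^~ s) (b ^~ s)).
Proof.
move=> sol i0 t0; have [_ _ /(_ t)int _] := sol i i0.
have [|iKa _ _ iJb] := int; first by rewrite /= ltry.
have am j : (0 < j)%N -> measurable_fun `]0, t[ (a j) /\ [bounded a j x | x in `]0, t[].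
  move=> j0; apply: within_continuous_bounded_measurable => //.
  exact: solution_continuous sol j0.
have [mai bai] := am i i0.
have ia j : (0 < j)%N -> (@lebesgue_measure R).-integrable `]0, t[ (EFin \o a j).
  move=> j0; have [maj baj] := am j j0.
  apply: measurable_bounded_integrable => //.
  by rewrite /= lebesgue_measure_itv/= lte_fin; case: ifP => _; rewrite ltry.
apply: integrableB => //; last exact: integrableMr.
apply: integrableB => //; last exact: integrableMr.
(* The range of [j] is repeated as a filter so that both [j] and [i - j] are known to be positive
   under the sum. *)
rewrite (_ : (fun s => _) = (fun s => (2^-1)%:E *
    \sum_(j <- index_iota 1 i | (0 < j < i)%N)
      ((K j (i - j)%N)%:E * ((EFin \o a j) \* (EFin \o a (i - j)%N)) s))%E).
  apply: integrableZl => //; apply: integrable_sum => // j /andP[j0 ji].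
  apply: integrableZl => //; have [maj baj] := am j j0.
  by apply: integrableMr => //; apply: ia; rewrite subn_gt0.
apply/funext => s; rewrite EFinM big_nat -sumEFin big_mkcond [in RHS]big_mkcond.
congr (_ * _)%E; apply: eq_bigr => j _; case: ifP => // _.
by rewrite -mulrA EFinM EFinM.
Qed.

(** The weighted equations are summed over $i<n$ and integrated. The full loss sums dominate their
    truncations at [n], so the integrand is at most the truncated mass rate, which is non-positive.
    The argument runs in extended reals because finiteness of the rate sums is derived from this
    bound only later. *)
Lemma solution_mass_le_pos (R : realType) (kappa kappa' alpha : R)
    (K J : nat -> nat -> R) (a0 b0 : nat -> R) (a b : nat -> R -> R) (n : nat) (t : R) :
  rate_kernel kappa alpha K -> rate_kernel kappa' alpha J ->
  is_solution K J +oo%E a0 b0 a b -> 0 < t ->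
  \sum_(1 <= i < n) i%:R * a i t <= \sum_(1 <= i < n) i%:R * a0 i.
Proof.
move=> hK hJ sol t0.
pose mu := @lebesgue_measure R.
pose F i s := ca_rhs K J i (a ^~ s) (b ^~ s).
have intF i : (0 < i)%N -> mu.-integrable `]0, t[ (F i).
  by move=> i0; apply: solution_ca_rhs_integrable sol i0 (ltW t0).
have eqF i : (0 < i)%N -> (\int[mu]_(s in `]0%R, t[) F i s = (a i t - a0 i)%:E)%E.
  move=> i0; have [_ _ _ eqn] := sol i i0.
  have [+ _] := eqn t (conj (ltW t0) (ltry t)) t0.
  rewrite -/(F i) -/mu; case: (\int[mu]_(s in `]0%R, t[) F i s)%E => [r| |]//= [->].
  by congr (_%:E); ring.
rewrite -subr_le0 -sumrB -lee_fin -sumEFin.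
have -> : (\sum_(1 <= i < n) (i%:R * a i t - i%:R * a0 i)%:E =
   \int[mu]_(s in `]0%R, t[) (\sum_(0 <= i < n.-1) i.+1%:R%:E * F i.+1 s))%E.
  rewrite integral_sum//=; last by move=> i; apply: integrableZl => //; exact: intF.
  rewrite big_add1; apply: eq_bigr => i _.
  rewrite integralZl//; last exact: intF.
  by rewrite eqF// -mulrBr.
apply: (@le_trans _ _ (\int[mu]_(s in `]0%R, t[) cst 0 s)%E); last by rewrite integral0.
apply: le_integral => //.
- by apply: integrable_sum => // i _; apply: integrableZl => //; exact: intF.
- exact: integrable0.
move=> s; rewrite inE/= in_itv/= => /andP[/ltW s0 _].
have as0 i : (0 < i)%N -> 0 <= a i s by move=> i0; apply: solution_ge0 sol i0 s0.
have bs0 i : (0 < i)%N -> 0 <= b i s.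
  by move=> i0; apply: solution_ge0 (solution_swap sol) i0 s0.
apply: (@le_trans _ _ (\sum_(0 <= i < n.-1)
    (i.+1%:R * trunc_rhs K J n i.+1 (a ^~ s) (b ^~ s))%:E)%E); last first.
  rewrite sumEFin lee_fin.
  have := trunc_mass_rate_le0 n hK hJ as0 bs0.
  by rewrite big_add1.
apply: lee_sum => i _; rewrite EFinM lee_wpmul2l ?lee_fin//.
rewrite /F /ca_rhs /trunc_rhs !EFinB !EFinM -!sumEFin.
have part (G : nat -> nat -> R) (z : nat -> R -> R) :
    (forall j, (0 < j)%N -> 0 <= G i.+1 j) -> (forall j, (0 < j)%N -> 0 <= z j s) ->
    ((a i.+1 s)%:E * \sum_(1 <= j < n) (G i.+1 j * z j s)%:E <=
     (a i.+1 s)%:E * rate_sum G i.+1 (z ^~ s))%E.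
  move=> G0 z0; apply: lee_wpmul2l; first by rewrite lee_fin as0.
  apply: nneseries_lim_ge => j j1 _.
  by rewrite lee_fin mulr_ge0 ?G0 ?z0.
by apply: leeB; [apply: leeB => //|]; apply: part => // j j0;
  [case: (hK i.+1 j isT j0)|case: (hJ i.+1 j isT j0)].
Qed.

(** Since $\alpha\le1$, $(ij)^\alpha\le i^\alpha j$, so the mass controls the rate sums uniformly in
    [N]. *)
Lemma rate_sum_le (R : realType) (kappa alpha m : R) (K : nat -> nat -> R)
    (i N : nat) (x : nat -> R) :
  0 <= alpha -> alpha <= 1 -> 0 < kappa -> rate_kernel kappa alpha K -> (0 < i)%N ->
  (forall j, (0 < j)%N -> 0 <= x j) -> \sum_(1 <= j < N) j%:R * x j <= m ->
  \sum_(1 <= j < N) K i j * x j <= kappa * i%:R `^ alpha * m.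
Proof.
move=> a0 a1 k0 hK i0 x0 xm.
apply: le_trans (ler_wpM2l _ xm); last by rewrite mulr_ge0 ?powR_ge0 ?ltW.
rewrite mulr_sumr !big_nat; apply: ler_sum => j /andP[j0 _].
rewrite mulrA ler_wpM2r ?x0//; have [_ _ Kij] := hK i j i0 j0.
apply: le_trans Kij _; rewrite natrM powRM// mulrA ler_wpM2l//.
  by rewrite mulr_ge0 ?powR_ge0 ?ltW.
by rewrite -[leRHS]powRr1//; apply: ler_powR => //; rewrite ler1n.
Qed.

Lemma nneseries_fin_cvg (R : realType) (x : nat -> R) (M : R) :
  (forall j, (0 < j)%N -> 0 <= x j) -> (forall N, \sum_(1 <= j < N) x j <= M) ->
  (\sum_(1 <= j <oo) (x j)%:E)%E \is a fin_num /\
  (fun N => \sum_(1 <= j < N) x j) @ \oo --> fine (\sum_(1 <= j <oo) (x j)%:E)%E.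
Proof.
move=> x0 xM.
have xE0 n : (1 <= n)%N -> true -> (0 <= (x n)%:E)%E by move=> n0 _; rewrite lee_fin x0.
have cv := is_cvg_nneseries xE0.
have fin : (\sum_(1 <= j <oo) (x j)%:E)%E \is a fin_num.
  rewrite ge0_fin_numE; last by apply: nneseries_ge0 => n n1 _; exact: xE0.
  apply: (@le_lt_trans _ _ M%:E); last by rewrite ltry.
  by apply: lime_le => //; apply: nearW => N; rewrite sumEFin lee_fin.
split => //.
have -> : (fun N => \sum_(1 <= j < N) x j) =
    fine \o (fun N => \sum_(1 <= j < N) (x j)%:E)%E.
  by apply/funext => N /=; rewrite sumEFin.
by apply: fine_cvg; rewrite fineK.
Qed.

(** Bounded mass makes both rate series converge. Estimates for [trunc_rhs] that are uniform in [N]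
    therefore pass to the real right-hand side. *)
Lemma ca_rhs_fin_cvg (R : realType) (kappa kappa' alpha m m' : R)
    (K J : nat -> nat -> R) (i : nat) (x y : nat -> R) :
  0 <= alpha -> alpha <= 1 -> 0 < kappa -> 0 < kappa' ->
  rate_kernel kappa alpha K -> rate_kernel kappa' alpha J -> (0 < i)%N ->
  (forall j, (0 < j)%N -> 0 <= x j) -> (forall j, (0 < j)%N -> 0 <= y j) ->
  (forall N, \sum_(1 <= j < N) j%:R * x j <= m) ->
  (forall N, \sum_(1 <= j < N) j%:R * y j <= m') ->
  ca_rhs K J i x y = (fine (ca_rhs K J i x y))%:E /\
  (fun N => trunc_rhs K J N i x y) @ \oo --> fine (ca_rhs K J i x y).
Proof.
move=> al0 al1 k0 k'0 hK hJ i0 x0 y0 xm ym.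
have Kx0 j : (0 < j)%N -> 0 <= K i j * x j.
  by move=> j0; rewrite mulr_ge0 ?x0//; case: (hK i j i0 j0).
have Jy0 j : (0 < j)%N -> 0 <= J i j * y j.
  by move=> j0; rewrite mulr_ge0 ?y0//; case: (hJ i j i0 j0).
have [fK cK] := nneseries_fin_cvg Kx0 (fun N => rate_sum_le al0 al1 k0 hK i0 x0 (xm N)).
have [fJ cJ] := nneseries_fin_cvg Jy0 (fun N => rate_sum_le al0 al1 k'0 hJ i0 y0 (ym N)).
rewrite /ca_rhs /rate_sum -(fineK fK) -(fineK fJ) -!EFinM -!EFinB; split => //=.
apply: cvgB; last by apply: cvgM => //; exact: cvg_cst.
by apply: cvgB; [exact: cvg_cst|apply: cvgM => //; exact: cvg_cst].
Qed.

(** Every $x_j$ is at most the mass bound [m], and [rate_sum_le] bounds the loss sums; the constant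
    depends neither on [N] nor on the sequences. *)
Lemma trunc_rhs_bounded (R : realType) (kappa kappa' alpha m m' : R)
    (K J : nat -> nat -> R) (i : nat) :
  0 <= alpha -> alpha <= 1 -> 0 < kappa -> 0 < kappa' ->
  rate_kernel kappa alpha K -> rate_kernel kappa' alpha J -> (0 < i)%N ->
  exists L : R, forall (N : nat) (x y : nat -> R),
    (forall j, (0 < j)%N -> 0 <= x j) -> (forall j, (0 < j)%N -> 0 <= y j) ->
    (forall n, \sum_(1 <= j < n) j%:R * x j <= m) ->
    (forall n, \sum_(1 <= j < n) j%:R * y j <= m') ->
    `|trunc_rhs K J N i x y| <= L.
Proof.
move=> al0 al1 k0 k'0 hK hJ i0.
exists (2^-1 * \sum_(1 <= j < i) K j (i - j)%N * m * m
  + m * (kappa * i%:R `^ alpha * m) + m * (kappa' * i%:R `^ alpha * m')).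
move=> N x y x0 y0 xm ym.
have xle j : (0 < j)%N -> x j <= m.
  move=> j0; apply: le_trans (xm j.+1).
  rewrite big_nat_recr//= ler_wpDl//.
    by rewrite big_nat sumr_ge0// => k /andP[k0' _]; rewrite mulr_ge0 ?x0.
  by rewrite ler_peMl ?x0// ler1n.
have m0 : 0 <= m by apply: le_trans (x0 i i0) (xle i i0).
have SK0 : 0 <= \sum_(1 <= j < N) K i j * x j.
  rewrite big_nat sumr_ge0// => j /andP[j0 _].
  by rewrite mulr_ge0 ?x0//; case: (hK i j i0 j0).
have SJ0 : 0 <= \sum_(1 <= j < N) J i j * y j.
  rewrite big_nat sumr_ge0// => j /andP[j0 _].
  by rewrite mulr_ge0 ?y0//; case: (hJ i j i0 j0).
have SKle := rate_sum_le al0 al1 k0 hK i0 x0 (xm N).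
have SJle := rate_sum_le al0 al1 k'0 hJ i0 y0 (ym N).
have conv : 0 <= \sum_(1 <= j < i) K j (i - j)%N * x j * x (i - j)%N <=
    \sum_(1 <= j < i) K j (i - j)%N * m * m.
  rewrite !big_nat sumr_ge0/=; last first.
    move=> j /andP[j0 ji]; have ij0 : (0 < i - j)%N by rewrite subn_gt0.
    have [Kj0 _ _] := hK _ _ j0 ij0.
    by rewrite mulr_ge0 ?x0// mulr_ge0 ?x0.
  apply: ler_sum => j /andP[j0 ji]; have ij0 : (0 < i - j)%N by rewrite subn_gt0.
  have [Kj0 _ _] := hK _ _ j0 ij0.
  by rewrite ler_pM ?mulr_ge0 ?x0 ?xle// ler_wpM2l ?xle.
have := ler_pM (x0 i i0) SK0 (xle i i0) SKle.
have := ler_pM (x0 i i0) SJ0 (xle i i0) SJle.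
have := mulr_ge0 (x0 i i0) SK0; have := mulr_ge0 (x0 i i0) SJ0.
case/andP: conv; rewrite /trunc_rhs ler_norml; lra.
Qed.

Lemma fine_wnorm_ge0 (R : realType) (p : R) (x : nat -> R) : 0 <= fine (wnorm p x).
Proof.
by rewrite fine_ge0// nneseries_ge0// => i _ _; rewrite lee_fin mulr_ge0 ?powR_ge0.
Qed.

Lemma Xplus_mass_le (R : realType) (x : nat -> R) (n : nat) :
  Xplus 1 x -> \sum_(1 <= i < n) i%:R * x i <= fine (wnorm 1 x).
Proof.
move=> [xfin x0].
have w0 i : (0 <= (i%:R `^ 1 * `|x i|)%:E)%E by rewrite lee_fin mulr_ge0 ?powR_ge0.
have fin : wnorm 1 x \is a fin_num by rewrite ge0_fin_numE// nneseries_ge0.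
rewrite -lee_fin (fineK fin) -sumEFin.
apply: le_trans (nneseries_lim_ge n (fun i _ _ => w0 i)).
rewrite big_nat [leRHS]big_nat; apply: lee_sum => i /andP[i0 _].
by rewrite powRr1// ger0_norm ?x0.
Qed.

(** The integral equations are given only for $t>0$, so the value at 0 has to be recovered by
    continuity before they become a statement on $[0,\infty)$. *)
Lemma solution_primitive (R : realType) (kappa kappa' alpha : R)
    (K J : nat -> nat -> R) (a0 b0 : nat -> R) (a b : nat -> R -> R) :
  0 <= alpha -> alpha <= 1 -> 0 < kappa -> 0 < kappa' ->
  rate_kernel kappa alpha K -> rate_kernel kappa' alpha J ->
  Xplus 1 a0 -> Xplus 1 b0 -> is_solution K J +oo%E a0 b0 a b ->
  forall i, (0 < i)%N ->
  a i 0 = a0 i /\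
  is_primitive (a i) (fun s => fine (ca_rhs K J i (a ^~ s) (b ^~ s))).
Proof.
move=> al0 al1 k0 k'0 hK hJ Xa Xb sol i i0.
pose mu := @lebesgue_measure R.
pose F s := fine (ca_rhs K J i (a ^~ s) (b ^~ s)).
have sol' := solution_swap sol.
have a_ge0 s : 0 <= s -> forall j, (0 < j)%N -> 0 <= a j s.
  by move=> s0 j j0; apply: solution_ge0 sol j0 s0.
have b_ge0 s : 0 <= s -> forall j, (0 < j)%N -> 0 <= b j s.
  by move=> s0 j j0; apply: solution_ge0 sol' j0 s0.
have ma s : 0 < s -> forall n, \sum_(1 <= j < n) j%:R * a j s <= fine (wnorm 1 a0).
  move=> s0 n; apply: le_trans (Xplus_mass_le n Xa).
  exact: solution_mass_le_pos hK hJ sol s0.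
have mb s : 0 < s -> forall n, \sum_(1 <= j < n) j%:R * b j s <= fine (wnorm 1 b0).
  move=> s0 n; apply: le_trans (Xplus_mass_le n Xb).
  exact: solution_mass_le_pos hK hJ sol' s0.
have FE s : 0 < s -> ca_rhs K J i (a ^~ s) (b ^~ s) = (F s)%:E.
  move=> s0; have s0' := ltW s0.
  by have [] := ca_rhs_fin_cvg al0 al1 k0 k'0 hK hJ i0
    (a_ge0 s s0') (b_ge0 s s0') (ma s s0) (mb s s0).
have [L hL] := trunc_rhs_bounded (fine (wnorm 1 a0)) (fine (wnorm 1 b0))
  al0 al1 k0 k'0 hK hJ i0.
have FL s : 0 < s -> `|F s| <= L.
  move=> s0; have s0' := ltW s0.
  have [_ cv] := ca_rhs_fin_cvg al0 al1 k0 k'0 hK hJ i0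
    (a_ge0 s s0') (b_ge0 s s0') (ma s s0) (mb s s0).
  apply: (cvgr_to_le (cvg_norm cv)); apply: nearW => N /=.
  by apply: hL; [exact: a_ge0|exact: b_ge0|exact: ma|exact: mb].
have intF t : 0 <= t -> mu.-integrable `]0, t[ (EFin \o F).
  move=> t0; apply: eq_integrable (solution_ca_rhs_integrable sol i0 t0) => //.
  by move=> s; rewrite inE/= in_itv/= => /andP[/FE].
pose f t := a0 i + \int[mu]_(s in `]0, t[) F s.
have f0 : f 0 = a0 i by rewrite /f set_itvoo0// Rintegral_set0 addr0.
have prim : is_primitive f F.
  move=> s t s0 st; have t0 := le_trans s0 st.
  split.
    apply: (integrableS _ _ _ (intF t t0)) => //.
    by move=> r /=; rewrite !in_itv/= => /andP[/(le_lt_trans s0) -> ->].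
  rewrite /f opprD addrACA subrr add0r.
  have [->|s_neq_t] := eqVneq s t.
    by rewrite subrr set_itvoo0// Rintegral_set0.
  rewrite (Rintegral_itv_bndo_bndc (intF s s0)) Rintegral_itvB//.
  - exact: intF.
  - by rewrite bnd_simp lt_neqAle s_neq_t.
have af t : 0 < t -> a i t = f t.
  move=> t0; have [_ _ _ eqn] := sol i i0.
  have [E _] := eqn t (conj (ltW t0) (ltry t)) t0.
  apply: EFin_inj; rewrite E /f EFinD; congr (_ + _)%E.
  rewrite /Rintegral fineK.
    by apply: eq_integral => s; rewrite inE/= in_itv/= => /andP[/FE].
  by apply: integrable_fin_num => //; exact/intF/ltW.
(* For $t>0$, $|a_i(t)-a_i^0|\le Lt$; letting $t$ decrease to 0 leaves no gap at 0. *)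
have ai0 : a i 0 = a0 i.
  have cont : {within `[0, 1], continuous (a i)} by apply: solution_continuous sol i0.
  have [_ right0 _] := (continuous_within_itvP _ ltr01).1 cont.
  apply/eqP; rewrite -subr_eq0 -normr_le0.
  have lim0 : `|a i t - a0 i| - L * t @[t --> 0^'+] --> `|a i 0 - a0 i| - L * 0.
    apply: cvgB.
      by apply: cvg_norm; apply: cvgB => //; exact: cvg_cst.
    by apply: cvgM; [exact: cvg_cst|apply: cvg_at_right_filter; exact: cvg_id].
  rewrite mulr0 subr0 in lim0; apply: (cvgr_to_le lim0).
  near=> t; have t0 : 0 < t by near: t; exact: nbhs_right_gt.
  rewrite af// -f0 subr_le0 -[X in L * X]subr0.
  by apply: is_primitive_lipschitz prim (lexx 0) (ltW t0) _ => r r0 _; exact: FL.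
split => //.
have a_f t : 0 <= t -> a i t = f t.
  by rewrite le_eqVlt => /predU1P[<-|/af//]; rewrite ai0 f0.
by move=> s t s0 st; rewrite !a_f ?(le_trans s0 st)//; exact: prim.
Unshelve. all: end_near.
Qed.

Lemma solution_mass_le (R : realType) (kappa kappa' alpha : R)
    (K J : nat -> nat -> R) (a0 b0 : nat -> R) (a b : nat -> R -> R) (n : nat) (t : R) :
  0 <= alpha -> alpha <= 1 -> 0 < kappa -> 0 < kappa' ->
  rate_kernel kappa alpha K -> rate_kernel kappa' alpha J ->
  Xplus 1 a0 -> Xplus 1 b0 -> is_solution K J +oo%E a0 b0 a b -> 0 <= t ->
  \sum_(1 <= i < n) i%:R * a i t <= fine (wnorm 1 a0).
Proof.
move=> al0 al1 k0 k'0 hK hJ Xa Xb sol; rewrite le_eqVlt => /predU1P[<-|t0].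
  apply: le_trans (Xplus_mass_le n Xa); rewrite !big_nat; apply: ler_sum => i /andP[i0 _].
  by have [-> _] := solution_primitive al0 al1 k0 k'0 hK hJ Xa Xb sol i0.
by apply: le_trans (Xplus_mass_le n Xa); apply: solution_mass_le_pos hK hJ sol t0.
Qed.

Lemma solution_rhs_cvg (R : realType) (kappa kappa' alpha : R)
    (K J : nat -> nat -> R) (a0 b0 : nat -> R) (a b : nat -> R -> R) (i : nat) (t : R) :
  0 <= alpha -> alpha <= 1 -> 0 < kappa -> 0 < kappa' ->
  rate_kernel kappa alpha K -> rate_kernel kappa' alpha J ->
  Xplus 1 a0 -> Xplus 1 b0 -> is_solution K J +oo%E a0 b0 a b ->
  (0 < i)%N -> 0 <= t ->
  (fun N => trunc_rhs K J N i (a ^~ t) (b ^~ t)) @ \oo -->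
    fine (ca_rhs K J i (a ^~ t) (b ^~ t)).
Proof.
move=> al0 al1 k0 k'0 hK hJ Xa Xb sol i0 t0; have sol' := solution_swap sol.
have [] // := ca_rhs_fin_cvg al0 al1 k0 k'0 hK hJ i0
  (fun j j0 => solution_ge0 sol j0 t0) (fun j j0 => solution_ge0 sol' j0 t0)
  (fun N => solution_mass_le N al0 al1 k0 k'0 hK hJ Xa Xb sol t0)
  (fun N => solution_mass_le N al0 al1 k0 k'0 hK hJ Xb Xa sol' t0).
Qed.

(** The bound on truncated right-hand sides survives the limit, so each component has a bounded
    density. *)
Lemma solution_lipschitz (R : realType) (kappa kappa' alpha : R)
    (K J : nat -> nat -> R) (a0 b0 : nat -> R) (a b : nat -> R -> R) :
  0 <= alpha -> alpha <= 1 -> 0 < kappa -> 0 < kappa' ->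
  rate_kernel kappa alpha K -> rate_kernel kappa' alpha J ->
  Xplus 1 a0 -> Xplus 1 b0 -> is_solution K J +oo%E a0 b0 a b ->
  exists2 l : nat -> R, (forall i, 0 <= l i) &
    forall i s t, (0 < i)%N -> 0 <= s -> s <= t -> `|a i t - a i s| <= l i * (t - s).
Proof.
move=> al0 al1 k0 k'0 hK hJ Xa Xb sol; have sol' := solution_swap sol.
(* The constants are gathered into one sequence by choice; the dummy index 0 receives the constant
   0. *)
suff /choice[l hl] : forall i, exists l : R, 0 <= l /\
    ((0 < i)%N -> forall s t, 0 <= s -> s <= t -> `|a i t - a i s| <= l * (t - s)).
  by exists l => [i|i s t i0]; [exact: (hl i).1|exact: (hl i).2].
case=> [|i]; first by exists 0.
have [L hL] := trunc_rhs_bounded (fine (wnorm 1 a0)) (fine (wnorm 1 b0))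
  al0 al1 k0 k'0 hK hJ (ltn0Sn i).
have [_ prim] := solution_primitive al0 al1 k0 k'0 hK hJ Xa Xb sol (ltn0Sn i).
have lip s t : 0 <= s -> s <= t -> `|a i.+1 t - a i.+1 s| <= L * (t - s).
  move=> s0 st; apply: (is_primitive_lipschitz prim s0 st) => r sr _.
  have r0 := le_trans s0 (ltW sr).
  have cv := solution_rhs_cvg al0 al1 k0 k'0 hK hJ Xa Xb sol (ltn0Sn i) r0.
  apply: (cvgr_to_le (cvg_norm cv)); apply: nearW => N /=; apply: hL.
  - by move=> j j0; exact: solution_ge0 sol j0 r0.
  - by move=> j j0; exact: solution_ge0 sol' j0 r0.
  - by move=> n; exact: solution_mass_le al0 al1 k0 k'0 hK hJ Xa Xb sol r0.
  - by move=> n; exact: solution_mass_le al0 al1 k0 k'0 hK hJ Xb Xa sol' r0.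
exists L; split => //.
by have := le_trans (normr_ge0 _) (lip 0 1 (lexx 0) ler01); rewrite subr0 mulr1.
Qed.

(** The weighted estimate with sign defects $e_i=hc_i$ and masses replaced by their bounds. The
    error is linear in the step [h] with a coefficient independent of [N]; integration over the step
    makes it quadratic. *)
Lemma component_rate_le (R : realType) (kappa kappa' alpha beta m1 m2 m4 h : R)
    (K J : nat -> nat -> R) (n N : nat) (x x' y y' sg c : nat -> R) :
  0 <= alpha -> alpha <= beta -> alpha + beta <= 1 -> 0 < kappa -> 0 < kappa' ->
  rate_kernel kappa alpha K -> rate_kernel kappa' alpha J -> (n <= N)%N ->
  (forall i, (0 < i)%N -> [/\ 0 <= x i, 0 <= x' i & 0 <= y' i]) ->
  (forall N, \sum_(1 <= i < N) i%:R * x i <= m1) ->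
  (forall N, \sum_(1 <= i < N) i%:R * x' i <= m2) ->
  (forall N, \sum_(1 <= i < N) i%:R * y' i <= m4) ->
  0 <= h -> (forall i, 0 <= c i) ->
  (forall i, (0 < i)%N ->
    `|sg i| <= 1 /\ `|x i - x' i| - h * c i <= sg i * (x i - x' i)) ->
  \sum_(1 <= i < n) i%:R `^ beta *
    (sg i * (trunc_rhs K J N i x y - trunc_rhs K J N i x' y')) <=
  kappa * (m1 + m2) * (\sum_(1 <= i < N) i%:R `^ beta * `|x i - x' i|)
  + kappa' * m1 * (\sum_(1 <= i < N) i%:R `^ beta * `|y i - y' i|)
  + h * \sum_(1 <= i < n) i%:R `^ beta * (c i *
      (2^-1 * (kappa * i%:R `^ alpha * (m1 + m2)) + kappa' * i%:R `^ alpha * m4)).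
Proof.
move=> al0 ab ab1 k0 k'0 hK hJ nN pos xm x'm y'm h0 c0 hsg.
have al1 : alpha <= 1 by lra.
have sm N' : \sum_(1 <= i < N') i%:R * (x i + x' i) <= m1 + m2.
  by under eq_bigr do rewrite mulrDr; rewrite big_split lerD.
have w0 i (z : R) : 0 <= i%:R `^ beta * `|z| by rewrite mulr_ge0 ?powR_ge0.
have := weighted_trunc_rhs_diff_le y al0 ab ab1 k0 k'0 hK hJ nN pos (e := fun i => h * c i)
  (sg := sg) (fun i in_ => hsg i (andP in_).1).
move=> /le_trans; apply; apply: lerD; first apply: lerD.
- rewrite ler_wpM2r ?sumr_ge0// ler_wpM2l ?(ltW k0)//.
- rewrite ler_wpM2r ?sumr_ge0// ler_wpM2l ?(ltW k'0)//.
- rewrite mulr_sumr !big_nat; apply: ler_sum => i /andP[i0 _].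
  rewrite [leRHS]mulrCA ler_wpM2l ?powR_ge0// -mulrA ler_wpM2l// ler_wpM2l//.
  apply: lerD.
    rewrite ler_wpM2l ?invr_ge0//.
    by apply: rate_sum_le al0 al1 k0 hK i0 _ (sm N) => j /pos[? ? _]; rewrite addr_ge0.
  by apply: rate_sum_le al0 al1 k'0 hJ i0 _ (y'm N) => j /pos[].
Qed.

(** * Stability *)

Lemma cvg_sum_nat (R : realType) (n : nat) (f : nat -> nat -> R) (l : nat -> R) :
  (forall i, (0 < i)%N -> f i @ \oo --> l i) ->
  (fun N => \sum_(1 <= i < n) f i N) @ \oo --> \sum_(1 <= i < n) l i.
Proof.
move=> fl; elim: n => [|[|n] IH].
- by under eq_fun do rewrite big_geq//; rewrite big_geq//; exact: cvg_cst.
- by under eq_fun do rewrite big_geq//; rewrite big_geq//; exact: cvg_cst.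
- under eq_fun do rewrite big_nat_recr//=.
  by rewrite big_nat_recr//=; apply: cvgD => //; exact: fl.
Qed.

(** One [d] is lost in replacing [ur] by [ut] under the multiplier, another in comparing $|ut|$ with
    $|ur|$. *)
Lemma lipschitz_sg_ge (R : realType) (ur ut d : R) :
  `|ut - ur| <= d ->
  `|Num.sg ut| <= 1 /\ `|ur| - 2 * d <= Num.sg ut * ur.
Proof.
move=> ud; have sg1 : `|Num.sg ut| <= 1 by rewrite normr_sg; case: eqP.
split => //.
have : Num.sg ut * (ut - ur) <= d.
  apply: le_trans ud; rewrite (le_trans (ler_norm _))// normrM.
  by rewrite ler_piMl.
rewrite mulrBr -normrEsg; have := ler_distD ut ur 0; rewrite !subr0 distrC; lra.
Qed.

Lemma norm_increment_le (R : realType) (kappa kappa' alpha beta : R)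
    (K J : nat -> nat -> R) (a01 b01 a02 b02 : nat -> R)
    (a1 b1 a2 b2 : nat -> R -> R) (k : R) (n : nat) :
  0 <= alpha -> alpha <= beta -> alpha + beta <= 1 -> 0 < kappa -> 0 < kappa' ->
  rate_kernel kappa alpha K -> rate_kernel kappa' alpha J ->
  Xplus 1 a01 -> Xplus 1 b01 -> Xplus 1 a02 -> Xplus 1 b02 ->
  is_solution K J +oo%E a01 b01 a1 b1 -> is_solution K J +oo%E a02 b02 a2 b2 ->
  kappa * (fine (wnorm 1 a01) + fine (wnorm 1 a02)) + kappa' * fine (wnorm 1 b01) <= k ->
  kappa' * fine (wnorm 1 a01) + kappa * (fine (wnorm 1 b01) + fine (wnorm 1 b02)) <= k ->
  let Y m t := \sum_(1 <= i < m) i%:R `^ beta * `|a1 i t - a2 i t|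
             + \sum_(1 <= i < m) i%:R `^ beta * `|b1 i t - b2 i t| in
  exists C, forall s t g, 0 <= s -> s <= t ->
    (forall N r, s <= r -> r <= t -> Y N r <= g) ->
    Y n t - Y n s <= k * g * (t - s) + C * (t - s) ^+ 2.
Proof.
move=> al0 ab ab1 k0 k'0 hK hJ Xa1 Xb1 Xa2 Xb2 sol1 sol2 ka kb Y.
have al1 : alpha <= 1 by lra.
have sol1' := solution_swap sol1; have sol2' := solution_swap sol2.
have [la1 la10 lipa1] := solution_lipschitz al0 al1 k0 k'0 hK hJ Xa1 Xb1 sol1.
have [lb1 lb10 lipb1] := solution_lipschitz al0 al1 k0 k'0 hK hJ Xb1 Xa1 sol1'.
have [la2 la20 lipa2] := solution_lipschitz al0 al1 k0 k'0 hK hJ Xa2 Xb2 sol2.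
have [lb2 lb20 lipb2] := solution_lipschitz al0 al1 k0 k'0 hK hJ Xb2 Xa2 sol2'.
set ma1 := fine (wnorm 1 a01) in ka kb *; set mb1 := fine (wnorm 1 b01) in ka kb *.
set ma2 := fine (wnorm 1 a02) in ka kb *; set mb2 := fine (wnorm 1 b02) in ka kb *.
pose w i : R := i%:R `^ beta; have w0 i : 0 <= w i by exact: powR_ge0.
pose u i r := a1 i r - a2 i r; pose v i r := b1 i r - b2 i r.
(* The difference of two components is Lipschitz with the sum of their constants; the factor 2 is
   the cost of freezing the sign. *)
pose cu i := 2 * (la1 i + la2 i); pose cv i := 2 * (lb1 i + lb2 i).
have cu0 i : 0 <= cu i by rewrite mulr_ge0 ?addr_ge0.
have cv0 i : 0 <= cv i by rewrite mulr_ge0 ?addr_ge0.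
pose Du := \sum_(1 <= i < n) w i * (cu i *
  (2^-1 * (kappa * i%:R `^ alpha * (ma1 + ma2)) + kappa' * i%:R `^ alpha * mb2)).
pose Dv := \sum_(1 <= i < n) w i * (cv i *
  (2^-1 * (kappa * i%:R `^ alpha * (mb1 + mb2)) + kappa' * i%:R `^ alpha * ma2)).
exists (Du + Dv) => s t g s0 st Yg; have t0 := le_trans s0 st.
pose su i := Num.sg (u i t); pose sv i := Num.sg (v i t).
(* With signs frozen at [t], [P] is linear in the components and so has a primitive representation.
   It equals [Y n] at [t] and is at most [Y n] at [s]. *)
pose P r := \sum_(1 <= i < n) w i * (su i * u i r) + \sum_(1 <= i < n) w i * (sv i * v i r).
have YP : Y n t - Y n s <= P t - P s.
  apply: lerB; apply: lerD; apply: ler_sum => i _; rewrite ler_wpM2l//.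
  - by rewrite /su -normrEsg.
  - by rewrite /sv -normrEsg.
  - by rewrite (le_trans (ler_norm _))// normrM ler_piMl// normr_sg; case: eqP.
  - by rewrite (le_trans (ler_norm _))// normrM ler_piMl// normr_sg; case: eqP.
apply: (le_trans YP).
pose Fa1 i r := fine (ca_rhs K J i (a1 ^~ r) (b1 ^~ r)).
pose Fa2 i r := fine (ca_rhs K J i (a2 ^~ r) (b2 ^~ r)).
pose Fb1 i r := fine (ca_rhs K J i (b1 ^~ r) (a1 ^~ r)).
pose Fb2 i r := fine (ca_rhs K J i (b2 ^~ r) (a2 ^~ r)).
have prim : is_primitive P (fun r =>
    \sum_(1 <= i < n) w i * (su i * (Fa1 i r - Fa2 i r))
    + \sum_(1 <= i < n) w i * (sv i * (Fb1 i r - Fb2 i r))).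
  apply: is_primitiveD; apply: is_primitive_sum => i i0;
    apply: is_primitiveZ; apply: is_primitiveZ; apply: is_primitiveB.
  - by have [] := solution_primitive al0 al1 k0 k'0 hK hJ Xa1 Xb1 sol1 i0.
  - by have [] := solution_primitive al0 al1 k0 k'0 hK hJ Xa2 Xb2 sol2 i0.
  - by have [] := solution_primitive al0 al1 k0 k'0 hK hJ Xb1 Xa1 sol1' i0.
  - by have [] := solution_primitive al0 al1 k0 k'0 hK hJ Xb2 Xa2 sol2' i0.
have -> : k * g * (t - s) + (Du + Dv) * (t - s) ^+ 2 =
    (k * g + (t - s) * (Du + Dv)) * (t - s) by ring.
apply: (is_primitive_increment_le prim s0 st) => r sr rt.
have r0 := le_trans s0 (ltW sr).
(* The rate of [P] is the limit of the truncated rates [G]. Their bound for $N\ge n$ involves only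
   [g], not the norm sums up to [N], so it holds in the limit. *)
pose G N := \sum_(1 <= i < n) w i * (su i * (trunc_rhs K J N i (a1 ^~ r) (b1 ^~ r)
                                          - trunc_rhs K J N i (a2 ^~ r) (b2 ^~ r)))
  + \sum_(1 <= i < n) w i * (sv i * (trunc_rhs K J N i (b1 ^~ r) (a1 ^~ r)
                                  - trunc_rhs K J N i (b2 ^~ r) (a2 ^~ r))).
have Gcvg : G @ \oo --> \sum_(1 <= i < n) w i * (su i * (Fa1 i r - Fa2 i r))
    + \sum_(1 <= i < n) w i * (sv i * (Fb1 i r - Fb2 i r)).
  apply: cvgD; apply: cvg_sum_nat => i i0; (apply: cvgM; first exact: cvg_cst);
    (apply: cvgM; first exact: cvg_cst); apply: cvgB.
  - exact: (solution_rhs_cvg al0 al1 k0 k'0 hK hJ Xa1 Xb1 sol1 i0 r0).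
  - exact: (solution_rhs_cvg al0 al1 k0 k'0 hK hJ Xa2 Xb2 sol2 i0 r0).
  - exact: (solution_rhs_cvg al0 al1 k0 k'0 hK hJ Xb1 Xa1 sol1' i0 r0).
  - exact: (solution_rhs_cvg al0 al1 k0 k'0 hK hJ Xb2 Xa2 sol2' i0 r0).
apply: (cvgr_to_le Gcvg); near=> N.
have nN : (n <= N)%N by near: N; exact: nbhs_infty_ge.
have h0 : 0 <= t - s by rewrite subr_ge0.
have tr : t - r <= t - s by rewrite lerD2l lerN2 ltW.
have sg_le (p q : nat -> R -> R) (lp lq : nat -> R) :
    (forall i, 0 <= lp i) -> (forall i, 0 <= lq i) ->
    (forall i s t, (0 < i)%N -> 0 <= s -> s <= t -> `|p i t - p i s| <= lp i * (t - s)) ->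
    (forall i s t, (0 < i)%N -> 0 <= s -> s <= t -> `|q i t - q i s| <= lq i * (t - s)) ->
    forall i, (0 < i)%N -> `|Num.sg (p i t - q i t)| <= 1 /\
      `|p i r - q i r| - (t - s) * (2 * (lp i + lq i)) <=
      Num.sg (p i t - q i t) * (p i r - q i r).
  move=> lp0 lq0 lipp lipq i i0; rewrite [(t - s) * _]mulrC -mulrA.
  apply: lipschitz_sg_ge.
  rewrite (_ : p i t - q i t - _ = (p i t - p i r) - (q i t - q i r)); last by ring.
  apply: (le_trans (ler_normB _ _)); rewrite mulrDl; apply: lerD.
    by apply: le_trans (lipp i r t i0 r0 (ltW rt)) _; rewrite ler_wpM2l.
  by apply: le_trans (lipq i r t i0 r0 (ltW rt)) _; rewrite ler_wpM2l.
have rate_a := component_rate_le (b1 ^~ r) al0 ab ab1 k0 k'0 hK hJ nN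
  (x := a1 ^~ r) (x' := a2 ^~ r) (y' := b2 ^~ r) (c := cu) (sg := su)
  (fun i i0 => And3 (solution_ge0 sol1 i0 r0) (solution_ge0 sol2 i0 r0)
                    (solution_ge0 sol2' i0 r0))
  (fun m => solution_mass_le m al0 al1 k0 k'0 hK hJ Xa1 Xb1 sol1 r0)
  (fun m => solution_mass_le m al0 al1 k0 k'0 hK hJ Xa2 Xb2 sol2 r0)
  (fun m => solution_mass_le m al0 al1 k0 k'0 hK hJ Xb2 Xa2 sol2' r0)
  h0 cu0 (sg_le _ _ _ _ la10 la20 lipa1 lipa2).
have rate_b := component_rate_le (a1 ^~ r) al0 ab ab1 k0 k'0 hK hJ nN
  (x := b1 ^~ r) (x' := b2 ^~ r) (y' := a2 ^~ r) (c := cv) (sg := sv)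
  (fun i i0 => And3 (solution_ge0 sol1' i0 r0) (solution_ge0 sol2' i0 r0)
                    (solution_ge0 sol2 i0 r0))
  (fun m => solution_mass_le m al0 al1 k0 k'0 hK hJ Xb1 Xa1 sol1' r0)
  (fun m => solution_mass_le m al0 al1 k0 k'0 hK hJ Xb2 Xa2 sol2' r0)
  (fun m => solution_mass_le m al0 al1 k0 k'0 hK hJ Xa2 Xb2 sol2 r0)
  h0 cv0 (sg_le _ _ _ _ lb10 lb20 lipb1 lipb2).
apply: (le_trans (lerD rate_a rate_b)).
rewrite -/ma1 -/ma2 -/mb1 -/mb2 -/Du -/Dv.
have YN := Yg N r (ltW sr) (ltW rt); rewrite /Y in YN.
move: YN.
set U := \sum_(1 <= i < N) _; set V := \sum_(1 <= i < N) _ => YN.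
have U0 : 0 <= U by apply: sumr_ge0 => i _; rewrite mulr_ge0.
have V0 : 0 <= V by apply: sumr_ge0 => i _; rewrite mulr_ge0.
have kge0 : 0 <= k.
  by apply: le_trans ka; rewrite addr_ge0 ?mulr_ge0 ?addr_ge0 ?fine_wnorm_ge0 ?(ltW k0) ?(ltW k'0).
(* Adding both species, [U] collects the coefficient bounded in [ka] and [V] the one bounded in
   [kb], while $U+V\le g$. *)
have := ler_wpM2l kge0 YN; have := ler_wpM2r U0 ka; have := ler_wpM2r V0 kb.
lra.
Unshelve. all: end_near.
Qed.

Lemma wnorm2_le (R : realType) (beta c : R) (x y : nat -> R) :
  (forall n, \sum_(1 <= i < n) i%:R `^ beta * `|x i|
           + \sum_(1 <= i < n) i%:R `^ beta * `|y i| <= c) ->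
  (wnorm2 beta x y <= c%:E)%E.
Proof.
move=> le_c; rewrite /wnorm2 /wnorm.
have ge0 (z : nat -> R) n : (1 <= n)%N -> true -> (0 <= (n%:R `^ beta * `|z n|)%:E)%E.
  by rewrite lee_fin mulr_ge0 ?powR_ge0.
rewrite -nneseriesD//; apply: lime_le.
  by apply: is_cvg_nneseries => n n1 _; rewrite adde_ge0// ge0.
by apply: nearW => n; rewrite big_split/= !sumEFin -EFinD lee_fin.
Qed.

Lemma wnorm2_ge_partial (R : realType) (beta : R) (x y : nat -> R) (n : nat) :
  ((\sum_(1 <= i < n) i%:R `^ beta * `|x i|
           + \sum_(1 <= i < n) i%:R `^ beta * `|y i|)%:E <= wnorm2 beta x y)%E.
Proof.
rewrite EFinD -!sumEFin; apply: leeD; apply: nneseries_lim_ge => i _ _;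
  by rewrite lee_fin mulr_ge0 ?powR_ge0.
Qed.

Theorem proposition5p1 (R : realType) :
  exists C5 : R -> R -> R,
    (forall k t : R, 0 < C5 k t) /\
    forall (alpha kappa2 kappa3 beta : R) (K J : nat -> nat -> R)
      (a01 b01 a02 b02 : nat -> R) (a1 b1 a2 b2 : nat -> R -> R),
      0 <= alpha -> alpha <= 2^-1 ->
      0 < kappa2 -> 0 < kappa3 ->
      rate_kernel kappa2 alpha K -> rate_kernel kappa3 alpha J ->
      Xplus 1 a01 -> Xplus 1 b01 -> Xplus 1 a02 -> Xplus 1 b02 ->
      is_solution K J +oo%E a01 b01 a1 b1 ->
      is_solution K J +oo%E a02 b02 a2 b2 ->
      alpha <= beta -> alpha + beta <= 1 ->
      let C1 := kappa2 * (fine (wnorm 1 a01) + fine (wnorm 1 a02)) in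
      let C2 := kappa3 * fine (wnorm 1 a01) in
      let C3 := kappa2 * (fine (wnorm 1 b01) + fine (wnorm 1 b02)) in
      let C4 := kappa3 * fine (wnorm 1 b01) in
      let K' := Num.max (C1 + C4) (C2 + C3) in
      forall t : R, 0 <= t ->
        (wnorm2 beta (fun i => a1 i t - a2 i t)%R (fun i => b1 i t - b2 i t)%R
         <= (C5 K' t)%:E *
            wnorm2 beta (fun i => a1 i 0 - a2 i 0)%R
                        (fun i => b1 i 0 - b2 i 0)%R)%E.
Proof.
exists (fun k t => expR (k * t)); split=> [k t|]; first exact: expR_gt0.
move=> alpha kappa2 kappa3 beta K J a01 b01 a02 b02 a1 b1 a2 b2 al0 _ k0 k'0 hK hJ.
move=> Xa1 Xb1 Xa2 Xb2 sol1 sol2 ab ab1 C1 C2 C3 C4 K' t t0.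
have al1 : alpha <= 1 by lra.
pose Y m t := \sum_(1 <= i < m) i%:R `^ beta * `|a1 i t - a2 i t|
            + \sum_(1 <= i < m) i%:R `^ beta * `|b1 i t - b2 i t|.
(* A crude bound valid at all times: $\beta\le1$ gives $i^\beta\le i$, and $|p-q|\le p+q$ reduces
   the norm to the masses. *)
pose M := fine (wnorm 1 a01) + fine (wnorm 1 a02)
        + (fine (wnorm 1 b01) + fine (wnorm 1 b02)).
have sol1' := solution_swap sol1; have sol2' := solution_swap sol2.
have diff_le (p q : nat -> R -> R) (m1 m2 : R) n r :
    (forall i, (0 < i)%N -> 0 <= p i r) -> (forall i, (0 < i)%N -> 0 <= q i r) ->
    \sum_(1 <= i < n) i%:R * p i r <= m1 -> \sum_(1 <= i < n) i%:R * q i r <= m2 ->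
    \sum_(1 <= i < n) i%:R `^ beta * `|p i r - q i r| <= m1 + m2.
  move=> p0 q0 pm qm; apply: le_trans (lerD pm qm); rewrite -big_split/= !big_nat.
  apply: ler_sum => i /andP[i0 _]; rewrite -mulrDr ler_pM ?powR_ge0//.
    by rewrite -[leRHS]powRr1//; apply: ler_powR; [rewrite ler1n|lra].
  by have := p0 i i0; have := q0 i i0; rewrite ler_norml; lra.
have YM n r : 0 <= r -> Y n r <= M.
  move=> r0; apply: lerD; apply: diff_le => [i i0|i i0||].
  - exact: solution_ge0 sol1 i0 r0.
  - exact: solution_ge0 sol2 i0 r0.
  - exact: (solution_mass_le n al0 al1 k0 k'0 hK hJ Xa1 Xb1 sol1 r0).
  - exact: (solution_mass_le n al0 al1 k0 k'0 hK hJ Xa2 Xb2 sol2 r0).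
  - exact: solution_ge0 sol1' i0 r0.
  - exact: solution_ge0 sol2' i0 r0.
  - exact: (solution_mass_le n al0 al1 k0 k'0 hK hJ Xb1 Xa1 sol1' r0).
  - exact: (solution_mass_le n al0 al1 k0 k'0 hK hJ Xb2 Xa2 sol2' r0).
have M0 : 0 <= M by rewrite !addr_ge0// fine_wnorm_ge0.
set W0 := wnorm2 beta (fun i => a1 i 0 - a2 i 0) _.
have W0ge0 : (0 <= W0)%E.
  by rewrite adde_ge0// nneseries_ge0// => i _ _; rewrite lee_fin mulr_ge0 ?powR_ge0.
(* The crude bound at time 0 makes the initial distance finite, so the Gronwall argument can run in
   real numbers. *)
have W0fin : W0 \is a fin_num.
  rewrite ge0_fin_numE//; apply: (@le_lt_trans _ _ M%:E); last exact: ltry.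
  by apply: wnorm2_le => n; exact: YM.
have K'0 : 0 <= K'.
  rewrite /K' le_max; apply/orP; left.
  by rewrite addr_ge0 ?mulr_ge0 ?addr_ge0 ?fine_wnorm_ge0 ?(ltW k0) ?(ltW k'0).
rewrite -(fineK W0fin) -EFinM; apply: wnorm2_le => n.
apply: (@gronwall_family R Y K' (fine W0) M) => //; first exact: fine_ge0.
  by move=> m; rewrite -lee_fin fineK//; exact: wnorm2_ge_partial.
move=> m; apply: (norm_increment_le m al0 ab ab1 k0 k'0 hK hJ Xa1 Xb1 Xa2 Xb2 sol1 sol2).
  by rewrite /K' le_max lexx.
by rewrite /K' le_max lexx orbT.
Qed.
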